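(* Let $\mathcal V$ be a Cartesian closed category with finite limits and small coproducts. The following are equivalent: (1) for every set $I$ the adjunction $\amalg\dashv\langle i^*\rangle_{i\in I}$ between $\mathcal V^I$ and $\mathcal V/(I\bullet 1)$ is an adjoint equivalence; (2) $\mathcal V$ is extensive; (3) the oplax double functor $\operatorname{Int}:\mathcal V\text{-}\mathrm{Mat}\to\operatorname{Span}_d(\mathcal V)$ is a double equivalence; (4) the lax double functor $\operatorname{En}:\operatorname{Span}_d(\mathcal V)\to\mathcal V\text{-}\mathrm{Mat}$ is a double equivalence.
   Context: $1$ is the terminal object of $\mathcal V$; for a set $I$ and an object $X$, $I\bullet X$ is the $I$-fold copower (coproduct of $I$ copies of $X$); $\bar i:1\to I\bullet 1$ denotes the $i$-th coprojection; a map $u:I\to K$ of sets induces $u\bullet 1:I\bullet 1\to K\bullet 1$. Extensive: $\mathcal V$ has all small coproducts and for each small family $(X_i)_{i\in I}$ the functor $\prod_{i\in I}(\mathcal V/X_i)\to\mathcal V/(\amalg_{i}X_i)$, $(f_i)\mapsto\amalg_i f_i$, is an equivalence of categories. The adjunction: taking $X_i=1$ and $\mathcal V/1\cong\mathcal V$ gives $\amalg:\mathcal V^I\to\mathcal V/(I\bullet 1)$; its right adjoint $\langle i^*\rangle_{i\in I}$ has as $i$-th component the pullback along $\bar i:1\to I\bullet 1$. Pseudo-double category $\operatorname{Span}_d(\mathcal V)$: 0-cells are small sets; horizontal 1-cells $I\to J$ are spans $I\bullet1\xleftarrow{a_1}A\xrightarrow{a_2}J\bullet1$ in $\mathcal V$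 (composed by pullback); vertical 1-cells are maps of sets; a 2-cell from $(A,a_1,a_2):I\to J$ to $(B,b_1,b_2):K\to L$ with vertical boundary $u:I\to K$, $v:J\to L$ is a morphism $f:A\to B$ with $b_1f=(u\bullet1)a_1$ and $b_2f=(v\bullet 1)a_2$. Pseudo-double category $\mathcal V\text{-}\mathrm{Mat}$: 0-cells are small sets; horizontal 1-cells $I\to J$ are matrices $(M(i,j))_{i\in I,j\in J}$ of objects of $\mathcal V$, composed by $(i,k)\mapsto\amalg_{j}M(j,k)\times M(i,j)$ (with the appropriate matrices); vertical 1-cells are maps of sets; a 2-cell from $(M(i,j))$ to $(N(k,l))_{k\in K,l\in L}$ with vertical boundary $u:I\to K$, $v:J\to L$ is a family of morphisms $f_{i,j}:M(i,j)\to N(u(i),v(j))$ in $\mathcal V$. $\operatorname{Int}$ is the identity on 0-cells and vertical 1-cells, sends a matrix $M$ to the span $I\bullet1\leftarrow\amalg_{i,j}M(i,j)\to J\bullet1$ whose legs on $M(i,j)$ are the unique map to $1$ followed by $\bar i$, respectively $\bar j$, and sends $(f_{i,j})$ to the induced morphism between coproducts. $\operatorname{En}$ is the identity on 0-cells and vertical 1-cells, sends a span $I\bullet1\xleftarrow{v_I}A\xrightarrow{v_J}J\bullet1$ to the matrix whose $(i,j)$ entry is the pullback of $\langle v_I,v_J\rangle:A\to(I\bullet1)\times(J\bullet1)$ along $\langle\bar i,\bar j\rangle:1\to(I\bullet1)\times(J\bullet1)$, and acts on 2-cells by the induced morphisms of pullbacks. *)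

(* Defs.v *)
From Stdlib Require Import List FunctionalExtensionality ProofIrrelevance.
From mathcomp Require Import ssreflect ssrfun ssrbool.

Set Implicit Arguments.
Unset Strict Implicit.
Unset Printing Implicit Defensive.

Declare Scope cat_scope.
Delimit Scope cat_scope with cat.
Local Open Scope cat_scope.

Definition SmallSet := Type.

Record Category := {
  Ob :> Type;
  Hom : Ob -> Ob -> Type;
  idm : forall A, Hom A A;
  compm : forall A B C, Hom B C -> Hom A B -> Hom A C;
  compm1 : forall A B (f : Hom A B), compm f (idm A) = f;
  comp1m : forall A B (f : Hom A B), compm (idm B) f = f;
  compmA : forall A B C D (h : Hom C D) (g : Hom B C) (f : Hom A B),
    compm (compm h g) f = compm h (compm g f)
}.
Arguments Hom {c} A B.
Arguments idm {c} A.
Arguments compm {c A B C} g f.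
Arguments compm1 {c A B} f.
Arguments comp1m {c A B} f.
Arguments compmA {c A B C D} h g f.
Notation "g ∘ f" := (compm g f) (at level 40, left associativity) : cat_scope.

Definition is_iso (C : Category) (A B : C) (f : Hom A B) : Prop :=
  exists g : Hom B A, g ∘ f = idm A /\ f ∘ g = idm B.

Record Functor (C D : Category) := {
  fobj :> C -> D;
  fmap : forall A B : C, Hom A B -> Hom (fobj A) (fobj B);
  fmap1 : forall A, fmap (idm A) = idm (fobj A);
  fmapD : forall A B C (g : Hom B C) (f : Hom A B),
    fmap (g ∘ f) = fmap g ∘ fmap f
}.
Arguments fmap {C D} F {A B} f : rename.
Arguments fmap1 {C D} F A : rename.
Arguments fmapD {C D} F {A B C0} g f : rename.

Definition functor_id (C : Category) : Functor C C :=
  @Build_Functor C C (fun A => A) (fun _ _ f => f)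
    (fun _ => erefl) (fun _ _ _ _ _ => erefl).

Section FunctorComp.
Context (C D E : Category) (G : Functor D E) (F : Functor C D).

Lemma functor_comp1 (A : C) : fmap G (fmap F (idm A)) = idm (G (F A)).
Proof. by rewrite !fmap1. Qed.

Lemma functor_compD (X Y Z : C) (g : Hom Y Z) (f : Hom X Y) :
  fmap G (fmap F (g ∘ f)) = fmap G (fmap F g) ∘ fmap G (fmap F f).
Proof. by rewrite !fmapD. Qed.

Definition functor_comp : Functor C E :=
  @Build_Functor C E (fun A => G (F A)) (fun _ _ f => fmap G (fmap F f))
    functor_comp1 functor_compD.
End FunctorComp.

Record NatTrans (C D : Category) (F G : Functor C D) := {
  nt :> forall A, Hom (F A) (G A);
  nt_nat : forall A B (f : Hom A B), fmap G f ∘ nt A = nt B ∘ fmap F f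
}.

Definition nat_iso (C D : Category) (F G : Functor C D) (a : NatTrans F G) :=
  forall A, is_iso (a A).

Definition is_equivalence (C D : Category) (F : Functor C D) : Prop :=
  exists (G : Functor D C)
    (eta : NatTrans (functor_id C) (functor_comp G F))
    (eps : NatTrans (functor_comp F G) (functor_id D)),
    nat_iso eta /\ nat_iso eps.

Record Adjunction (C D : Category) (L : Functor C D) (R : Functor D C) := {
  adj_unit : NatTrans (functor_id C) (functor_comp R L);
  adj_counit : NatTrans (functor_comp L R) (functor_id D);
  adj_triangleL : forall A, adj_counit (L A) ∘ fmap L (adj_unit A) = idm (L A);
  adj_triangleR : forall B, fmap R (adj_counit B) ∘ adj_unit (R B) = idm (R B)
}.

Definition is_adjoint_equivalence (C D : Category) (L : Functor C D)
    (R : Functor D C) (adj : Adjunction L R) : Prop :=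
  nat_iso (adj_unit adj) /\ nat_iso (adj_counit adj).

Definition SET : Category :=
  @Build_Category SmallSet (fun I J => I -> J) (fun _ i => i)
    (fun _ _ _ v u i => v (u i))
    (fun _ _ _ => erefl) (fun _ _ _ => erefl) (fun _ _ _ _ _ _ _ => erefl).

Section ProductCategory.
Context (I : SmallSet) (C : I -> Category).

Definition prod_cat : Category.
Proof.
refine (@Build_Category (forall i, C i) (fun A B => forall i, Hom (A i) (B i))
  (fun A i => idm (A i)) (fun _ _ _ g f i => g i ∘ f i) _ _ _).
- by move=> A B f; apply: functional_extensionality_dep => i; apply: compm1.
- by move=> A B f; apply: functional_extensionality_dep => i; apply: comp1m.
- move=> A B X Y h g f; apply: functional_extensionality_dep => i.
  exact: compmA.
Defined.

End ProductCategory.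

Definition prod_functor (I : SmallSet) (C D : I -> Category)
  (F : forall i, Functor (C i) (D i)) : Functor (prod_cat C) (prod_cat D).
Proof.
refine (@Build_Functor (prod_cat C) (prod_cat D) (fun A i => F i (A i))
  (fun _ _ f i => fmap (F i) (f i)) _ _).
- by move=> A; apply: functional_extensionality_dep => i; apply: fmap1.
- move=> A B X g f; apply: functional_extensionality_dep => i; exact: fmapD.
Defined.

Section Slice.
Context (C : Category) (X : C).

Record slice_ob := { slice_dom : C; slice_map : Hom slice_dom X }.

Definition slice_hom (A B : slice_ob) :=
  {h : Hom (slice_dom A) (slice_dom B) | slice_map B ∘ h = slice_map A}.

Lemma slice_hom_eq (A B : slice_ob) (f g : slice_hom A B) :
  sval f = sval g -> f = g.
Proof.
case: f g => [f e] [g e'] /= fg; case: g / fg e' => e'.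
by rewrite (proof_irrelevance _ e e').
Qed.

Lemma slice_idP (A : slice_ob) : slice_map A ∘ idm (slice_dom A) = slice_map A.
Proof. exact: compm1. Qed.

Lemma slice_compP (A B D : slice_ob) (g : slice_hom B D) (f : slice_hom A B) :
  slice_map D ∘ (sval g ∘ sval f) = slice_map A.
Proof. by rewrite -compmA (svalP g) (svalP f). Qed.

Definition slice : Category.
Proof.
refine (@Build_Category slice_ob slice_hom (fun A => exist _ _ (slice_idP A))
  (fun A B D g f => exist _ _ (slice_compP g f)) _ _ _).
- by move=> A B f; apply: slice_hom_eq; apply: compm1.
- by move=> A B f; apply: slice_hom_eq; apply: comp1m.
- by move=> A B D E h g f; apply: slice_hom_eq; apply: compmA.
Defined.
End Slice.

Definition finite_type (T : Type) : Prop := exists s : list T, forall x, In x s.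

Definition finite_category (J : Category) : Prop :=
  finite_type J /\ forall x y : J, finite_type (Hom x y).

Record Cone (J C : Category) (F : Functor J C) (A : C) := {
  cone_leg :> forall j, Hom A (F j);
  cone_nat : forall j k (m : Hom j k), fmap F m ∘ cone_leg j = cone_leg k
}.

Record Limit (J C : Category) (F : Functor J C) := {
  lim_ob : C;
  lim_cone : Cone F lim_ob;
  lim_map : forall A, Cone F A -> Hom A lim_ob;
  lim_fac : forall A (c : Cone F A) j, lim_cone j ∘ lim_map c = c j;
  lim_ext : forall A (f g : Hom A lim_ob),
    (forall j, lim_cone j ∘ f = lim_cone j ∘ g) -> f = g
}.

Definition FiniteLimits (C : Category) : Type :=
  forall J : Category, finite_category J -> forall F : Functor J C, Limit F.

Definition empty_cat : Category.
Proof.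
refine (@Build_Category Empty_set (fun _ _ => Empty_set)
  (fun A => match A with end) (fun A _ _ _ _ => match A with end) _ _ _);
  by case.
Defined.

Lemma empty_cat_finite : finite_category empty_cat.
Proof. by split; [exists nil|]; case. Qed.

Definition empty_diagram (C : Category) : Functor empty_cat C.
Proof.
refine (@Build_Functor empty_cat C (fun A => match A with end)
  (fun A _ _ => match A with end) _ _); by case.
Defined.

Definition pair_cat : Category.
Proof.
refine (@Build_Category bool (fun x y => x = y) (fun _ => erefl)
  (fun _ _ _ g f => etrans f g) _ _ _).
- by move=> A B; case: B /.
- by move=> A B; case: B /.
- by move=> A B X Y h g f; case: Y / h; case: X / g.
Defined.

Lemma pair_cat_finite : finite_category pair_cat.
Proof.
split; first by exists (cons true (cons false nil)); case; [left|right; left].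
move=> x y; case: (Bool.bool_dec x y) => [e|ne].
  by exists (cons e nil) => e'; left; exact: (@proof_irrelevance (x = y) e e').
by exists nil => e; case: ne.
Qed.

Definition pair_diagram (C : Category) (A B : C) : Functor pair_cat C.
Proof.
refine (@Build_Functor pair_cat C (fun b : bool => if b then A else B)
  (fun x y e => match e in _ = z return
     Hom (if x then A else B) (if z then A else B) with erefl => idm _ end) _ _).
- by [].
- by move=> x y z g f; case: z / g; rewrite comp1m.
Defined.

Inductive cospan_shape := cs_left | cs_right | cs_corner.

Definition cospan_hom (x y : cospan_shape) : Type :=
  match x, y with
  | cs_left, cs_left | cs_right, cs_right | _, cs_corner => unit
  | _, _ => Empty_set
  end.

Definition cospan_id (x : cospan_shape) : cospan_hom x x :=
  match x with cs_left => tt | cs_right => tt | cs_corner => tt end.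

Definition cospan_comp (x y z : cospan_shape) :
  cospan_hom y z -> cospan_hom x y -> cospan_hom x z.
Proof. by case: x; case: y; case: z. Defined.

Definition cospan_cat : Category.
Proof.
refine (@Build_Category cospan_shape cospan_hom cospan_id cospan_comp _ _ _).
- by case; case; case.
- by case; case; case.
- by case; case; case; case.
Defined.

Lemma cospan_cat_finite : finite_category cospan_cat.
Proof.
split.
  exists (cons cs_left (cons cs_right (cons cs_corner nil))).
  by case; [left|right; left|right; right; left].
by case; case; (by exists nil; case) || (by exists (cons tt nil); case; left).
Qed.

Section CospanDiagram.
Context (C : Category) (A B X : C) (f : Hom A X) (g : Hom B X).

Definition cospan_ob (x : cospan_shape) : C :=
  match x with cs_left => A | cs_right => B | cs_corner => X end.

Definition cospan_map (x y : cospan_shape) :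
    cospan_hom x y -> Hom (cospan_ob x) (cospan_ob y) :=
  match x, y return cospan_hom x y -> Hom (cospan_ob x) (cospan_ob y) with
  | cs_left, cs_left | cs_right, cs_right | cs_corner, cs_corner =>
      fun _ => idm _
  | cs_left, cs_corner => fun _ => f
  | cs_right, cs_corner => fun _ => g
  | cs_left, cs_right | cs_right, cs_left
  | cs_corner, cs_left | cs_corner, cs_right =>
      fun e => match e with end
  end.

Definition cospan_diagram : Functor cospan_cat C.
Proof.
refine (@Build_Functor cospan_cat C cospan_ob cospan_map _ _).
- by case.
- by case; case; case => //= *; rewrite ?compm1 ?comp1m.
Defined.
End CospanDiagram.

Section FiniteLimitTheory.
Context (C : Category) (L : FiniteLimits C).

Definition one : C := lim_ob (L empty_cat_finite (empty_diagram C)).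

Definition empty_cone (A : C) : Cone (empty_diagram C) A.
Proof.
by refine (@Build_Cone empty_cat C (empty_diagram C) A
  (fun j => match j with end) _); case.
Defined.

Definition bang (A : C) : Hom A one := lim_map _ (empty_cone A).

Lemma one_ext (A : C) (f g : Hom A one) : f = g.
Proof. by apply: lim_ext; case. Qed.

Section Product.
Context (A B : C).

Let lim := L pair_cat_finite (pair_diagram A B).

Definition prodm : C := lim_ob lim.
Definition pr1 : Hom prodm A := lim_cone lim true.
Definition pr2 : Hom prodm B := lim_cone lim false.

Definition pair_cone (X : C) (f : Hom X A) (g : Hom X B) :
  Cone (pair_diagram A B) X.
Proof.
refine (@Build_Cone pair_cat C (pair_diagram A B) X
  (fun j : bool => if j return Hom X (if j then A else B) then f else g) _).
by move=> j k m; case: k / m; rewrite comp1m.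
Defined.

Definition pairm (X : C) (f : Hom X A) (g : Hom X B) : Hom X prodm :=
  lim_map lim (pair_cone f g).

Lemma pr1_pairm (X : C) (f : Hom X A) (g : Hom X B) : pr1 ∘ pairm f g = f.
Proof. exact: (lim_fac lim (pair_cone f g) true). Qed.

Lemma pr2_pairm (X : C) (f : Hom X A) (g : Hom X B) : pr2 ∘ pairm f g = g.
Proof. exact: (lim_fac lim (pair_cone f g) false). Qed.

Lemma prod_ext (X : C) (f g : Hom X prodm) :
  pr1 ∘ f = pr1 ∘ g -> pr2 ∘ f = pr2 ∘ g -> f = g.
Proof. by move=> e1 e2; apply: lim_ext; case. Qed.
End Product.

Section Pullback.
Context (A B X : C) (f : Hom A X) (g : Hom B X).

Let lim := L cospan_cat_finite (cospan_diagram f g).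

Definition pullback : C := lim_ob lim.
Definition pb1 : Hom pullback A := lim_cone lim cs_left.
Definition pb2 : Hom pullback B := lim_cone lim cs_right.

Lemma pb_comm : f ∘ pb1 = g ∘ pb2.
Proof.
have e1 := cone_nat (lim_cone lim) (tt : cospan_hom cs_left cs_corner).
have e2 := cone_nat (lim_cone lim) (tt : cospan_hom cs_right cs_corner).
exact: etrans e1 (esym e2).
Qed.

Section PullbackCone.
Context (Y : C) (h : Hom Y A) (k : Hom Y B) (e : f ∘ h = g ∘ k).

Definition pb_leg (j : cospan_shape) : Hom Y (cospan_ob A B X j) :=
  match j return Hom Y (cospan_ob A B X j) with
  | cs_left => h
  | cs_right => k
  | cs_corner => f ∘ h
  end.

Definition pb_cone : Cone (cospan_diagram f g) Y.
Proof.
refine (@Build_Cone cospan_cat C (cospan_diagram f g) Y pb_leg _).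
by case; case => //= *; rewrite ?comp1m // e.
Defined.

Definition pbpair : Hom Y pullback := lim_map lim pb_cone.

Lemma pb1_pbpair : pb1 ∘ pbpair = h.
Proof. exact: (lim_fac lim pb_cone cs_left). Qed.

Lemma pb2_pbpair : pb2 ∘ pbpair = k.
Proof. exact: (lim_fac lim pb_cone cs_right). Qed.
End PullbackCone.

Lemma pb_ext (Y : C) (h k : Hom Y pullback) :
  pb1 ∘ h = pb1 ∘ k -> pb2 ∘ h = pb2 ∘ k -> h = k.
Proof.
move=> e1 e2; apply: lim_ext; case => //=.
have e := cone_nat (lim_cone lim) (tt : cospan_hom cs_left cs_corner).
by rewrite -e !compmA; congr (_ ∘ _); exact: e1.
Qed.
End Pullback.

End FiniteLimitTheory.
Arguments pbpair {C L A B X f g Y h k} e.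
Arguments pr1 {C L A B}.
Arguments pr2 {C L A B}.
Arguments pairm {C L A B X} f g.
Arguments bang {C L} A.
Arguments pb1 {C L A B X f g}.
Arguments pb2 {C L A B X f g}.

Record CartesianClosed (C : Category) (L : FiniteLimits C) := {
  expo : C -> C -> C;
  evalm : forall Y Z, Hom (prodm L (expo Y Z) Y) Z;
  curry : forall X Y Z, Hom (prodm L X Y) Z -> Hom X (expo Y Z);
  curryK : forall X Y Z (f : Hom (prodm L X Y) Z),
    evalm Y Z ∘ pairm (curry f ∘ pr1) pr2 = f;
  curry_ext : forall X Y Z (f g : Hom X (expo Y Z)),
    evalm Y Z ∘ pairm (f ∘ @pr1 C L X Y) pr2
      = evalm Y Z ∘ pairm (g ∘ @pr1 C L X Y) pr2 -> f = g
}.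

Record SmallCoproducts (C : Category) := {
  coprod : forall I : SmallSet, (I -> C) -> C;
  inj : forall (I : SmallSet) (X : I -> C) i, Hom (X i) (coprod X);
  copair : forall (I : SmallSet) (X : I -> C) Z,
    (forall i, Hom (X i) Z) -> Hom (coprod X) Z;
  copair_inj : forall (I : SmallSet) (X : I -> C) Z
    (f : forall i, Hom (X i) Z) i, copair f ∘ inj X i = f i;
  coprod_ext : forall (I : SmallSet) (X : I -> C) Z (f g : Hom (coprod X) Z),
    (forall i, f ∘ inj X i = g ∘ inj X i) -> f = g
}.
Arguments coprod {C} S {I} X : rename.
Arguments inj {C S I X} i : rename.
Arguments copair {C S I X Z} f : rename.
Arguments copair_inj {C S I X Z} f i : rename.

Lemma copair_inj_comp (V : Category) (S : SmallCoproducts V) (I : SmallSet)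
    (X : I -> V) (Z W : V) (f : forall i, Hom (X i) Z) i (h : Hom W (X i)) :
  copair f ∘ (@inj V S I X i ∘ h) = f i ∘ h.
Proof. by rewrite -compmA (@copair_inj V S I X Z f i). Qed.

Section PairTheory.
Context (C : Category) (L : FiniteLimits C).

Lemma pairm_comp (A B X Y : C) (f : Hom X A) (g : Hom X B) (h : Hom Y X) :
  @pairm C L _ _ _ f g ∘ h = pairm (f ∘ h) (g ∘ h).
Proof.
by apply: prod_ext; rewrite -compmA ?pr1_pairm ?pr2_pairm.
Qed.

Lemma pairm_pr (A B : C) : @pairm C L A B _ pr1 pr2 = idm _.
Proof. by apply: prod_ext; rewrite ?pr1_pairm ?pr2_pairm compm1. Qed.

Lemma pairm_pr_comp (A B X : C) (h : Hom X (prodm L A B)) :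
  pairm (pr1 ∘ h) (pr2 ∘ h) = h.
Proof. by rewrite -pairm_comp pairm_pr comp1m. Qed.

Context (A B X Y Z : C) (f : Hom A X) (g : Hom B X) (h : Hom Y A) (k : Hom Y B)
  (e : f ∘ h = g ∘ k) (l : Hom Z Y).

Lemma pb1_pbpair_comp : pb1 ∘ (@pbpair C L _ _ _ _ _ _ _ _ e ∘ l) = h ∘ l.
Proof. by rewrite -compmA pb1_pbpair. Qed.

Lemma pb2_pbpair_comp : pb2 ∘ (@pbpair C L _ _ _ _ _ _ _ _ e ∘ l) = k ∘ l.
Proof. by rewrite -compmA pb2_pbpair. Qed.
End PairTheory.

(* The patterns are matched syntactically, so that no definition is unfolded
   and the families of objects are not left to higher-order unification. *)
Ltac cat_step :=
  match goal with
  | |- context [@compm ?C ?A ?B ?D (@compm _ _ ?X _ ?h ?g) ?f] =>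
      rewrite (@compmA C A B X D h g f)
  | |- context [@compm ?C ?A _ ?B ?f (@idm _ _)] => rewrite (@compm1 C A B f)
  | |- context [@compm ?C ?A _ ?B (@idm _ _) ?f] => rewrite (@comp1m C A B f)
  | |- context [@compm ?C ?Y _ _ (@pairm _ ?L ?A ?B ?X ?f ?g) ?h] =>
      rewrite (@pairm_comp C L A B X Y f g h)
  | |- context [@compm ?C _ _ _ pr1 (@pairm _ ?L ?A ?B ?X ?f ?g)] =>
      rewrite (@pr1_pairm C L A B X f g)
  | |- context [@compm ?C _ _ _ pr2 (@pairm _ ?L ?A ?B ?X ?f ?g)] =>
      rewrite (@pr2_pairm C L A B X f g)
  | |- context [@pairm ?C ?L ?A ?B (prodm _ ?A ?B) pr1 pr2] =>
      rewrite (@pairm_pr C L A B)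
  | |- context [@pairm ?C ?L ?A ?B ?X (pr1 ∘ ?h) (pr2 ∘ ?h)] =>
      rewrite (@pairm_pr_comp C L A B X h)
  | |- context [@compm _ _ _ _ pb1
                  (@pbpair ?C ?L ?A ?B ?X ?f ?g ?Y ?h ?k ?e)] =>
      rewrite (@pb1_pbpair C L A B X f g Y h k e)
  | |- context [@compm _ _ _ _ pb2
                  (@pbpair ?C ?L ?A ?B ?X ?f ?g ?Y ?h ?k ?e)] =>
      rewrite (@pb2_pbpair C L A B X f g Y h k e)
  | |- context [@compm _ ?Z _ _ pb1
         (@compm _ _ _ _ (@pbpair ?C ?L ?A ?B ?X ?f ?g ?Y ?h ?k ?e) ?l)] =>
      rewrite (@pb1_pbpair_comp C L A B X Y Z f g h k e l)
  | |- context [@compm _ ?Z _ _ pb2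
         (@compm _ _ _ _ (@pbpair ?C ?L ?A ?B ?X ?f ?g ?Y ?h ?k ?e) ?l)] =>
      rewrite (@pb2_pbpair_comp C L A B X Y Z f g h k e l)
  | |- context [@compm _ _ _ _ (@copair ?V ?S ?I ?X ?Z ?f) (@inj _ _ _ _ ?i)] =>
      rewrite (@copair_inj V S I X Z f i)
  | |- context [@compm _ _ _ _ (@copair ?V ?S ?I ?X ?Z ?f)
                  (@compm _ ?W _ _ (@inj _ _ _ _ ?i) ?h)] =>
      rewrite (@copair_inj_comp V S I X Z W f i h)
  end.

Ltac cat_norm := simpl; repeat (progress (repeat (cat_step; cbv beta); simpl)).


Section SliceCoproduct.
Context (V : Category) (S : SmallCoproducts V) (I : SmallSet) (X : I -> V).

Definition slice_coprod_ob (f : prod_cat (fun i => slice (X i))) :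
    slice (coprod S X) :=
  @Build_slice_ob V (coprod S X) (coprod S (fun i => slice_dom (f i)))
    (copair (fun i => inj i ∘ slice_map (f i))).

Definition slice_coprod_map (f g : prod_cat (fun i => slice (X i)))
    (h : Hom f g) :
    Hom (slice_dom (slice_coprod_ob f)) (slice_dom (slice_coprod_ob g)) :=
  copair (fun i => @inj V S I (fun i => slice_dom (g i)) i ∘ sval (h i)).

Arguments slice_coprod_map f g h /.

Lemma slice_coprod_mapP (f g : prod_cat (fun i => slice (X i)))
    (h : Hom f g) :
  slice_map (slice_coprod_ob g) ∘ slice_coprod_map h
  = slice_map (slice_coprod_ob f).
Proof.
by apply: coprod_ext => i; cat_norm; rewrite (svalP (h i)).
Qed.

Definition slice_coprod :
  Functor (prod_cat (fun i => slice (X i))) (slice (coprod S X)).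
Proof.
refine (@Build_Functor (prod_cat (fun i => slice (X i))) (slice (coprod S X))
  slice_coprod_ob (fun f g h => exist _ _ (slice_coprod_mapP h)) _ _).
- by move=> f; apply: slice_hom_eq; apply: coprod_ext => i; cat_norm.
- by move=> f g k h' h; apply: slice_hom_eq; apply: coprod_ext => i; cat_norm.
Defined.
End SliceCoproduct.
Arguments slice_coprod_map {V S I X f g} h /.

Definition extensive (V : Category) (S : SmallCoproducts V) : Prop :=
  forall (I : SmallSet) (X : I -> V), is_equivalence (slice_coprod S X).

Section Copower.
Context (V : Category) (L : FiniteLimits V) (S : SmallCoproducts V).

(* $I \bullet 1$; [inj i] is then $\bar\imath$ *)
Definition copower1 (I : SmallSet) : V := coprod S (fun _ : I => one L).

Definition copower1_map (I K : SmallSet) (u : I -> K) :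
    Hom (copower1 I) (copower1 K) :=
  copair (fun i => inj (u i)).

Definition to_slice1 : Functor V (slice (one L)).
Proof.
refine (@Build_Functor V (slice (one L))
  (fun A => @Build_slice_ob V (one L) A (bang A))
  (fun A B f => exist _ f (one_ext _ _)) _ _).
- by move=> A; apply: slice_hom_eq.
- by move=> A B D g f; apply: slice_hom_eq.
Defined.

Section Adjunction.
Context (I : SmallSet).

Definition power_cat : Category := prod_cat (fun _ : I => V).

Definition coprod_functor : Functor power_cat (slice (copower1 I)) :=
  functor_comp (slice_coprod S (fun _ : I => one L))
    (prod_functor (fun _ : I => to_slice1)).

Definition fibre (f : slice (copower1 I)) (i : I) : V :=
  pullback L (slice_map f) (inj i).

Lemma fibre_mapP (f g : slice (copower1 I)) (h : Hom f g) (i : I) :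
  slice_map g ∘ (sval h ∘ pb1) = inj i ∘ @pb2 _ L _ _ _ (slice_map f) (inj i).
Proof. by rewrite -compmA (svalP h) pb_comm. Qed.

Definition fibre_functor : Functor (slice (copower1 I)) power_cat.
Proof.
refine (@Build_Functor (slice (copower1 I)) power_cat fibre
  (fun f g h i => pbpair (fibre_mapP h i)) _ _).
- move=> f; apply: functional_extensionality_dep => i.
  by apply: pb_ext; cat_norm.
- move=> f g k h' h; apply: functional_extensionality_dep => i.
  by apply: pb_ext; cat_norm.
Defined.

Lemma adj_unitP (X : power_cat) (i : I) :
  slice_map (coprod_functor X) ∘ inj i = inj i ∘ bang (X i).
Proof. by cat_norm. Qed.

Definition coprod_unit :
  NatTrans (functor_id power_cat) (functor_comp fibre_functor coprod_functor).
Proof.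
refine (@Build_NatTrans _ _ (functor_id power_cat)
  (functor_comp fibre_functor coprod_functor)
  (fun X i => pbpair (adj_unitP X i)) _).
move=> X Y f; apply: functional_extensionality_dep => i.
apply: pb_ext => /=; last by apply: one_ext.
by cat_norm.
Defined.

Lemma adj_counitP (f : slice (copower1 I)) :
  slice_map f ∘ copair (fun i => pb1)
  = slice_map (coprod_functor (fibre_functor f)).
Proof.
apply: coprod_ext => i; cat_norm; rewrite pb_comm.
by congr (_ ∘ _); apply: one_ext.
Qed.

Definition coprod_counit :
  NatTrans (functor_comp coprod_functor fibre_functor)
    (functor_id (slice (copower1 I))).
Proof.
refine (@Build_NatTrans _ _ (functor_comp coprod_functor fibre_functor)
  (functor_id (slice (copower1 I)))
  (fun f => exist _ _ (adj_counitP f)) _).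
move=> f g h; apply: slice_hom_eq; apply: coprod_ext => i.
by cat_norm.
Defined.

Definition coprod_adjunction : Adjunction coprod_functor fibre_functor.
Proof.
refine (@Build_Adjunction _ _ coprod_functor fibre_functor
  coprod_unit coprod_counit _ _).
- move=> X; apply: slice_hom_eq; apply: coprod_ext => i.
  by cat_norm.
- move=> f; apply: functional_extensionality_dep => i.
  apply: pb_ext => /=; last by apply: one_ext.
  by cat_norm.
Defined.
End Adjunction.
End Copower.

(* A 2-cell is indexed by its vertical boundary, so equations between 2-cells
   whose boundaries agree only propositionally are stated in the total space
   over all vertical boundaries. *)
Definition pack (X Y : Type) (P : X -> Y -> Type) (x : X) (y : Y) (p : P x y) :
    {x : X & {y : Y & P x y}} :=
  existT (fun x => {y : Y & P x y}) x (existT (P x) y p).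
Notation "p ≡ q" := (pack p = pack q) (at level 70) : cat_scope.

(* [hcomp M N] is in diagrammatic order. *)
Record PseudoDoubleCategory := {
  D0 :> Category;
  Hor : D0 -> D0 -> Type;
  Cell : forall {A B C D : D0}, Hor A B -> Hor C D -> Hom A C -> Hom B D -> Type;
  cid : forall {A B} (M : Hor A B), Cell M M (idm A) (idm B);
  ccomp : forall {A B C D E F} {M : Hor A B} {N : Hor C D} {P : Hor E F}
    {u : Hom A C} {v : Hom B D} {u' : Hom C E} {v' : Hom D F},
    Cell N P u' v' -> Cell M N u v -> Cell M P (u' ∘ u) (v' ∘ v);
  ccomp1 : forall {A B C D} {M : Hor A B} {N : Hor C D} {u v}
    (f : Cell M N u v), ccomp f (cid M) ≡ f;
  ccomp1l : forall {A B C D} {M : Hor A B} {N : Hor C D} {u v}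
    (f : Cell M N u v), ccomp (cid N) f ≡ f;
  ccompA : forall {A B C D E F G K} {M : Hor A B} {N : Hor C D} {P : Hor E F}
    {Q : Hor G K} {u v u' v' u'' v''}
    (h : Cell P Q u'' v'') (g : Cell N P u' v') (f : Cell M N u v),
    ccomp (ccomp h g) f ≡ ccomp h (ccomp g f);

  hid : forall A, Hor A A;
  hidc : forall {A C} (u : Hom A C), Cell (hid A) (hid C) u u;
  hidc1 : forall A, hidc (idm A) = cid (hid A);
  hidcD : forall {A C E} (u' : Hom C E) (u : Hom A C),
    hidc (u' ∘ u) = ccomp (hidc u') (hidc u);

  hcomp : forall {A B C}, Hor A B -> Hor B C -> Hor A C;
  hcompc : forall {A B C A' B' C'} {M : Hor A B} {N : Hor B C}
    {M' : Hor A' B'} {N' : Hor B' C'} {u v w},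
    Cell M M' u v -> Cell N N' v w -> Cell (hcomp M N) (hcomp M' N') u w;
  hcompc1 : forall {A B C} (M : Hor A B) (N : Hor B C),
    hcompc (cid M) (cid N) = cid (hcomp M N);
  hcompcD : forall {A B C A' B' C' A'' B'' C''}
    {M : Hor A B} {N : Hor B C} {M' : Hor A' B'} {N' : Hor B' C'}
    {M'' : Hor A'' B''} {N'' : Hor B'' C''} {u v w u' v' w'}
    (f' : Cell M' M'' u' v') (g' : Cell N' N'' v' w')
    (f : Cell M M' u v) (g : Cell N N' v w),
    hcompc (ccomp f' f) (ccomp g' g) = ccomp (hcompc f' g') (hcompc f g);

  hassoc : forall {A B C D} (M : Hor A B) (N : Hor B C) (P : Hor C D),
    Cell (hcomp (hcomp M N) P) (hcomp M (hcomp N P)) (idm A) (idm D);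
  hassoc_inv : forall {A B C D} (M : Hor A B) (N : Hor B C) (P : Hor C D),
    Cell (hcomp M (hcomp N P)) (hcomp (hcomp M N) P) (idm A) (idm D);
  hassocK : forall {A B C D} (M : Hor A B) (N : Hor B C) (P : Hor C D),
    ccomp (hassoc_inv M N P) (hassoc M N P) ≡ cid (hcomp (hcomp M N) P);
  hassoc_invK : forall {A B C D} (M : Hor A B) (N : Hor B C) (P : Hor C D),
    ccomp (hassoc M N P) (hassoc_inv M N P) ≡ cid (hcomp M (hcomp N P));
  hassoc_nat : forall {A B C D A' B' C' D'} {M : Hor A B} {N : Hor B C}
    {P : Hor C D} {M' : Hor A' B'} {N' : Hor B' C'} {P' : Hor C' D'} {u v w t}
    (f : Cell M M' u v) (g : Cell N N' v w) (h : Cell P P' w t),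
    ccomp (hassoc M' N' P') (hcompc (hcompc f g) h)
      ≡ ccomp (hcompc f (hcompc g h)) (hassoc M N P);

  hunitl : forall {A B} (M : Hor A B), Cell (hcomp (hid A) M) M (idm A) (idm B);
  hunitl_inv : forall {A B} (M : Hor A B),
    Cell M (hcomp (hid A) M) (idm A) (idm B);
  hunitlK : forall {A B} (M : Hor A B),
    ccomp (hunitl_inv M) (hunitl M) ≡ cid (hcomp (hid A) M);
  hunitl_invK : forall {A B} (M : Hor A B),
    ccomp (hunitl M) (hunitl_inv M) ≡ cid M;
  hunitl_nat : forall {A B A' B'} {M : Hor A B} {M' : Hor A' B'} {u v}
    (f : Cell M M' u v),
    ccomp (hunitl M') (hcompc (hidc u) f) ≡ ccomp f (hunitl M);

  hunitr : forall {A B} (M : Hor A B), Cell (hcomp M (hid B)) M (idm A) (idm B);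
  hunitr_inv : forall {A B} (M : Hor A B),
    Cell M (hcomp M (hid B)) (idm A) (idm B);
  hunitrK : forall {A B} (M : Hor A B),
    ccomp (hunitr_inv M) (hunitr M) ≡ cid (hcomp M (hid B));
  hunitr_invK : forall {A B} (M : Hor A B),
    ccomp (hunitr M) (hunitr_inv M) ≡ cid M;
  hunitr_nat : forall {A B A' B'} {M : Hor A B} {M' : Hor A' B'} {u v}
    (f : Cell M M' u v),
    ccomp (hunitr M') (hcompc f (hidc v)) ≡ ccomp f (hunitr M);

  hpentagon : forall {A B C D E} (M : Hor A B) (N : Hor B C) (P : Hor C D)
    (Q : Hor D E),
    ccomp (hassoc M N (hcomp P Q)) (hassoc (hcomp M N) P Q)
      ≡ ccomp (hcompc (cid M) (hassoc N P Q))
          (ccomp (hassoc M (hcomp N P) Q) (hcompc (hassoc M N P) (cid Q)));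
  htriangle : forall {A B C} (M : Hor A B) (N : Hor B C),
    ccomp (hcompc (cid M) (hunitl N)) (hassoc M (hid B) N)
      ≡ hcompc (hunitr M) (cid N)
}.
Arguments Hor {p} A B.
Arguments hid {p} A.

Definition cell_iso (D : PseudoDoubleCategory) (A B A' B' : D)
    (M : Hor A B) (N : Hor A' B') (u : Hom A A') (v : Hom B B')
    (f : Cell M N u v) : Prop :=
  exists (u' : Hom A' A) (v' : Hom B' B) (g : Cell N M u' v'),
    ccomp g f ≡ cid M /\ ccomp f g ≡ cid N.

(* The part of a lax or oplax double functor other than its comparison cells *)
Record DoubleMap (D E : PseudoDoubleCategory) := {
  dob :> Functor D E;
  dhor : forall {A B : D}, Hor A B -> Hor (dob A) (dob B);
  dcell : forall {A B A' B' : D} {M : Hor A B} {M' : Hor A' B'} {u v},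
    Cell M M' u v -> Cell (dhor M) (dhor M') (fmap dob u) (fmap dob v);
  dcell1 : forall {A B} (M : Hor A B), dcell (cid M) ≡ cid (dhor M);
  dcellD : forall {A B A' B' A'' B'' : D} {M : Hor A B} {M' : Hor A' B'}
    {M'' : Hor A'' B''} {u v u' v'}
    (g : Cell M' M'' u' v') (f : Cell M M' u v),
    dcell (ccomp g f) ≡ ccomp (dcell g) (dcell f)
}.
Arguments dhor {D E} F {A B} M : rename.
Arguments dcell {D E} F {A B A' B' M M' u v} f : rename.

Section PackCongruence.
Context (D E : PseudoDoubleCategory).

Lemma pack_ccomp (A B A' B' A'' B'' : D) (M : Hor A B) (M' : Hor A' B')
    (M'' : Hor A'' B'') u v u' v' s t s' t'
    (g : Cell M' M'' u' v') (f : Cell M M' u v)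
    (g1 : Cell M' M'' s' t') (f1 : Cell M M' s t) :
  g ≡ g1 -> f ≡ f1 -> ccomp g f ≡ ccomp g1 f1.
Proof.
move=> eg ef.
pose T (x : {u : Hom A' A'' & {v : Hom B' B'' & Cell M' M'' u v}})
  (y : {u : Hom A A' & {v : Hom B B' & Cell M M' u v}}) :=
  pack (ccomp (projT2 (projT2 x)) (projT2 (projT2 y))).
by change (T (pack g) (pack f) = T (pack g1) (pack f1)); rewrite eg ef.
Qed.

Lemma pack_dcell (F : DoubleMap D E) (A B A' B' : D) (M : Hor A B)
    (M' : Hor A' B') u v s t (f : Cell M M' u v) (f1 : Cell M M' s t) :
  f ≡ f1 -> dcell F f ≡ dcell F f1.
Proof.
move=> ef.
pose T (y : {u : Hom A A' & {v : Hom B B' & Cell M M' u v}}) :=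
  pack (dcell F (projT2 (projT2 y))).
by change (T (pack f) = T (pack f1)); rewrite ef.
Qed.
End PackCongruence.

Definition dm_id (D : PseudoDoubleCategory) : DoubleMap D D :=
  @Build_DoubleMap D D (functor_id D) (fun _ _ M => M)
    (fun _ _ _ _ _ _ _ _ f => f)
    (fun _ _ _ => erefl) (fun _ _ _ _ _ _ _ _ _ _ _ _ _ _ _ => erefl).

Definition dm_comp (D E F : PseudoDoubleCategory) (G : DoubleMap E F)
  (H : DoubleMap D E) : DoubleMap D F.
Proof.
refine (@Build_DoubleMap D F (functor_comp G H) (fun _ _ M => dhor G (dhor H M))
  (fun _ _ _ _ _ _ _ _ f => dcell G (dcell H f)) _ _).
- by move=> A B M; apply: etrans (pack_dcell G (dcell1 H M)) (dcell1 G _).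
- move=> A B A' B' A'' B'' M M' M'' u v u' v' g f.
  exact: etrans (pack_dcell G (dcellD H g f)) (dcellD G _ _).
Defined.

Definition ccast (D : PseudoDoubleCategory) (A B A' B' : D)
    (M : Hor A B) (N : Hor A' B') (u u' : Hom A A') (v v' : Hom B B')
    (eu : u = u') (ev : v = v') (f : Cell M N u v) : Cell M N u' v' :=
  match eu in _ = x, ev in _ = y return Cell M N x y with
  | erefl, erefl => f
  end.

Record LaxStructure (D E : PseudoDoubleCategory) (F : DoubleMap D E) := {
  lax_unit : forall A : D, Cell (hid (F A)) (dhor F (hid A)) (idm _) (idm _);
  lax_comp : forall {A B C : D} (M : Hor A B) (N : Hor B C),
    Cell (hcomp (dhor F M) (dhor F N)) (dhor F (hcomp M N)) (idm _) (idm _)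
}.
Arguments lax_unit {D E F} l A.
Arguments lax_comp {D E F} l {A B C} M N.

Record OplaxStructure (D E : PseudoDoubleCategory) (F : DoubleMap D E) := {
  oplax_unit : forall A : D, Cell (dhor F (hid A)) (hid (F A)) (idm _) (idm _);
  oplax_comp : forall {A B C : D} (M : Hor A B) (N : Hor B C),
    Cell (dhor F (hcomp M N)) (hcomp (dhor F M) (dhor F N)) (idm _) (idm _)
}.
Arguments oplax_unit {D E F} o A.
Arguments oplax_comp {D E F} o {A B C} M N.

Record LaxDoubleFunctor (D E : PseudoDoubleCategory) := {
  lmap :> DoubleMap D E;
  lstr : LaxStructure lmap;
  lax_unit_nat : forall {A A' : D} (u : Hom A A'),
    ccomp (dcell lmap (hidc u)) (lax_unit lstr A)
      ≡ ccomp (lax_unit lstr A') (hidc (fmap lmap u));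
  lax_comp_nat : forall {A B C A' B' C' : D} {M : Hor A B} {N : Hor B C}
    {M' : Hor A' B'} {N' : Hor B' C'} {u v w}
    (f : Cell M M' u v) (g : Cell N N' v w),
    ccomp (dcell lmap (hcompc f g)) (lax_comp lstr M N)
      ≡ ccomp (lax_comp lstr M' N') (hcompc (dcell lmap f) (dcell lmap g));
  lax_assoc : forall {A B C X : D} (M : Hor A B) (N : Hor B C) (P : Hor C X),
    ccomp (dcell lmap (hassoc M N P))
      (ccomp (lax_comp lstr (hcomp M N) P)
         (hcompc (lax_comp lstr M N) (cid (dhor lmap P))))
    ≡ ccomp (lax_comp lstr M (hcomp N P))
        (ccomp (hcompc (cid (dhor lmap M)) (lax_comp lstr N P))
           (hassoc (dhor lmap M) (dhor lmap N) (dhor lmap P)));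
  lax_unitl : forall {A B : D} (M : Hor A B),
    ccomp (dcell lmap (hunitl M))
      (ccomp (lax_comp lstr (hid A) M)
         (hcompc (lax_unit lstr A) (cid (dhor lmap M))))
    ≡ hunitl (dhor lmap M);
  lax_unitr : forall {A B : D} (M : Hor A B),
    ccomp (dcell lmap (hunitr M))
      (ccomp (lax_comp lstr M (hid B))
         (hcompc (cid (dhor lmap M)) (lax_unit lstr B)))
    ≡ hunitr (dhor lmap M)
}.

Record OplaxDoubleFunctor (D E : PseudoDoubleCategory) := {
  omap :> DoubleMap D E;
  ostr : OplaxStructure omap;
  oplax_unit_nat : forall {A A' : D} (u : Hom A A'),
    ccomp (hidc (fmap omap u)) (oplax_unit ostr A)
      ≡ ccomp (oplax_unit ostr A') (dcell omap (hidc u));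
  oplax_comp_nat : forall {A B C A' B' C' : D} {M : Hor A B} {N : Hor B C}
    {M' : Hor A' B'} {N' : Hor B' C'} {u v w}
    (f : Cell M M' u v) (g : Cell N N' v w),
    ccomp (hcompc (dcell omap f) (dcell omap g)) (oplax_comp ostr M N)
      ≡ ccomp (oplax_comp ostr M' N') (dcell omap (hcompc f g));
  oplax_assoc : forall {A B C X : D} (M : Hor A B) (N : Hor B C) (P : Hor C X),
    ccomp (hcompc (cid (dhor omap M)) (oplax_comp ostr N P))
      (ccomp (oplax_comp ostr M (hcomp N P)) (dcell omap (hassoc M N P)))
    ≡ ccomp (hassoc (dhor omap M) (dhor omap N) (dhor omap P))
        (ccomp (hcompc (oplax_comp ostr M N) (cid (dhor omap P)))
           (oplax_comp ostr (hcomp M N) P));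
  oplax_unitl : forall {A B : D} (M : Hor A B),
    ccomp (hunitl (dhor omap M))
      (ccomp (hcompc (oplax_unit ostr A) (cid (dhor omap M)))
         (oplax_comp ostr (hid A) M))
    ≡ dcell omap (hunitl M);
  oplax_unitr : forall {A B : D} (M : Hor A B),
    ccomp (hunitr (dhor omap M))
      (ccomp (hcompc (cid (dhor omap M)) (oplax_unit ostr B))
         (oplax_comp ostr M (hid B)))
    ≡ dcell omap (hunitr M)
}.

Definition lax_str_id (D : PseudoDoubleCategory) : LaxStructure (dm_id D) :=
  @Build_LaxStructure D D (dm_id D)
    (fun A => cid (hid A)) (fun _ _ _ M N => cid (hcomp M N)).

Definition oplax_str_id (D : PseudoDoubleCategory) : OplaxStructure (dm_id D) :=
  @Build_OplaxStructure D D (dm_id D)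
    (fun A => cid (hid A)) (fun _ _ _ M N => cid (hcomp M N)).

Section CompositeComparison.
Context (D E F : PseudoDoubleCategory) (G : DoubleMap E F) (H : DoubleMap D E).

Lemma fmap1_idl (A : E) : fmap G (idm A) ∘ idm (G A) = idm (G A).
Proof. by rewrite compm1 fmap1. Qed.

Lemma fmap1_idr (A : E) : idm (G A) ∘ fmap G (idm A) = idm (G A).
Proof. by rewrite comp1m fmap1. Qed.

(* A vertical transformation into or out of a composite refers only to the
   comparison cells of the composite, not to their coherence. *)
Definition lax_str_comp (g : LaxStructure G) (h : LaxStructure H) :
    LaxStructure (dm_comp G H) :=
  @Build_LaxStructure D F (dm_comp G H)
    (fun A => ccast (fmap1_idl _) (fmap1_idl _)
       (ccomp (dcell G (lax_unit h A)) (lax_unit g (H A))))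
    (fun A B C M N => ccast (fmap1_idl _) (fmap1_idl _)
       (ccomp (dcell G (lax_comp h M N)) (lax_comp g (dhor H M) (dhor H N)))).

Definition oplax_str_comp (g : OplaxStructure G) (h : OplaxStructure H) :
    OplaxStructure (dm_comp G H) :=
  @Build_OplaxStructure D F (dm_comp G H)
    (fun A => ccast (fmap1_idr _) (fmap1_idr _)
       (ccomp (oplax_unit g (H A)) (dcell G (oplax_unit h A))))
    (fun A B C M N => ccast (fmap1_idr _) (fmap1_idr _)
       (ccomp (oplax_comp g (dhor H M) (dhor H N))
          (dcell G (oplax_comp h M N)))).
End CompositeComparison.

Record VTrans (D E : PseudoDoubleCategory) (F G : DoubleMap D E) := {
  vt0 :> NatTrans F G;
  vt1 : forall {A B : D} (M : Hor A B), Cell (dhor F M) (dhor G M) (vt0 A) (vt0 B);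
  vt1_nat : forall {A B A' B' : D} {M : Hor A B} {M' : Hor A' B'} {u v}
    (f : Cell M M' u v),
    ccomp (dcell G f) (vt1 M) ≡ ccomp (vt1 M') (dcell F f)
}.
Arguments vt1 {D E F G} a {A B} M : rename.

Definition vt_iso (D E : PseudoDoubleCategory) (F G : DoubleMap D E)
    (a : VTrans F G) : Prop :=
  nat_iso a /\ forall (A B : D) (M : Hor A B), cell_iso (vt1 a M).

Definition lax_vtrans (D E : PseudoDoubleCategory) (F G : DoubleMap D E)
    (f : LaxStructure F) (g : LaxStructure G) (a : VTrans F G) : Prop :=
  (forall A : D,
     ccomp (lax_unit g A) (hidc (a A)) ≡ ccomp (vt1 a (hid A)) (lax_unit f A))
  /\ (forall (A B C : D) (M : Hor A B) (N : Hor B C),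
     ccomp (lax_comp g M N) (hcompc (vt1 a M) (vt1 a N))
       ≡ ccomp (vt1 a (hcomp M N)) (lax_comp f M N)).

Definition oplax_vtrans (D E : PseudoDoubleCategory) (F G : DoubleMap D E)
    (f : OplaxStructure F) (g : OplaxStructure G) (a : VTrans F G) : Prop :=
  (forall A : D,
     ccomp (hidc (a A)) (oplax_unit f A)
       ≡ ccomp (oplax_unit g A) (vt1 a (hid A)))
  /\ (forall (A B C : D) (M : Hor A B) (N : Hor B C),
     ccomp (hcompc (vt1 a M) (vt1 a N)) (oplax_comp f M N)
       ≡ ccomp (oplax_comp g M N) (vt1 a (hcomp M N))).

Definition lax_is_pseudo (D E : PseudoDoubleCategory)
    (F : LaxDoubleFunctor D E) : Prop :=
  (forall A : D, cell_iso (lax_unit (lstr F) A))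
  /\ forall (A B C : D) (M : Hor A B) (N : Hor B C),
       cell_iso (lax_comp (lstr F) M N).

Definition oplax_is_pseudo (D E : PseudoDoubleCategory)
    (F : OplaxDoubleFunctor D E) : Prop :=
  (forall A : D, cell_iso (oplax_unit (ostr F) A))
  /\ forall (A B C : D) (M : Hor A B) (N : Hor B C),
       cell_iso (oplax_comp (ostr F) M N).

(* Equivalence in the 2-category of pseudo-double categories, pseudo double
   functors and vertical transformations; a pseudo double functor is a lax
   (resp. oplax) one whose comparison cells are invertible. *)
Definition lax_double_equivalence (D E : PseudoDoubleCategory)
    (F : LaxDoubleFunctor D E) : Prop :=
  lax_is_pseudo F /\
  exists G : LaxDoubleFunctor E D, lax_is_pseudo G /\
  exists (eta : VTrans (dm_id D) (dm_comp G F))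
    (eps : VTrans (dm_comp F G) (dm_id E)),
    [/\ lax_vtrans (lax_str_id D) (lax_str_comp (lstr G) (lstr F)) eta,
        lax_vtrans (lax_str_comp (lstr F) (lstr G)) (lax_str_id E) eps,
        vt_iso eta & vt_iso eps].

Definition oplax_double_equivalence (D E : PseudoDoubleCategory)
    (F : OplaxDoubleFunctor D E) : Prop :=
  oplax_is_pseudo F /\
  exists G : OplaxDoubleFunctor E D, oplax_is_pseudo G /\
  exists (eta : VTrans (dm_id D) (dm_comp G F))
    (eps : VTrans (dm_comp F G) (dm_id E)),
    [/\ oplax_vtrans (oplax_str_id D) (oplax_str_comp (ostr G) (ostr F)) eta,
        oplax_vtrans (oplax_str_comp (ostr F) (ostr G)) (oplax_str_id E) eps,
        vt_iso eta & vt_iso eps].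


Section Distributivity.
Context (V : Category) (L : FiniteLimits V) (E : CartesianClosed L)
  (S : SmallCoproducts V).

Definition jointly_epic (I : SmallSet) (X : I -> V) (Y : V)
    (e : forall i, Hom (X i) Y) : Prop :=
  forall Z (f g : Hom Y Z), (forall i, f ∘ e i = g ∘ e i) -> f = g.

Lemma jepi_inj (I : SmallSet) (X : I -> V) :
  jointly_epic (fun i => @inj V S I X i).
Proof. by move=> Z f g; apply: coprod_ext. Qed.

Lemma eval_curry (X Y Z W : V) (f : Hom (prodm L X Y) Z) (a : Hom W X)
    (b : Hom W Y) : evalm E Y Z ∘ pairm (curry E f ∘ a) b = f ∘ pairm a b.
Proof. by rewrite -[f in RHS](curryK E); cat_norm. Qed.

Lemma jepi_l (I : SmallSet) (X : I -> V) (Y A : V)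
    (e : forall i, Hom (X i) Y) : jointly_epic e ->
  jointly_epic (fun i => @pairm V L Y A (prodm L (X i) A) (e i ∘ pr1) pr2).
Proof.
move=> ee Z f g fg; rewrite -(curryK E f) -(curryK E g).
suff -> : curry E f = curry E g by [].
apply: ee => i; apply: curry_ext; rewrite !compmA !eval_curry; exact: fg.
Qed.

Lemma jepi_r (I : SmallSet) (X : I -> V) (Y A : V)
    (e : forall i, Hom (X i) Y) : jointly_epic e ->
  jointly_epic (fun i => @pairm V L A Y (prodm L A (X i)) pr1 (e i ∘ pr2)).
Proof.
move=> ee Z f g fg.
have swapK : @pairm V L A Y _ pr2 pr1 ∘ @pairm V L Y A _ pr2 pr1 = idm _.
  by cat_norm.
rewrite -[f]compm1 -[g]compm1 -swapK -!compmA; congr (_ ∘ _).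
apply: (jepi_l ee) => i;
  have := congr1
    (fun h => h ∘ @pairm V L A (X i) (prodm L (X i) A) pr2 pr1) (fg i).
by cat_norm.
Qed.

Section Dcopair.
Context (I : SmallSet) (X : I -> V) (A Z : V).

(* The products with [A] preserve coproducts by cartesian closedness *)
Definition dcopair_l (f : forall i, Hom (prodm L (X i) A) Z) :
    Hom (prodm L (coprod S X) A) Z :=
  evalm E A Z ∘ pairm (copair (fun i => curry E (f i)) ∘ pr1) pr2.

Definition dcopair_r (f : forall i, Hom (prodm L A (X i)) Z) :
    Hom (prodm L A (coprod S X)) Z :=
  dcopair_l (fun i => f i ∘ pairm pr2 pr1) ∘ pairm pr2 pr1.

Lemma dcopair_l_inj f i (W : V) (a : Hom W (X i)) (b : Hom W A) :
  dcopair_l f ∘ pairm (@inj V S I X i ∘ a) b = f i ∘ pairm a b.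
Proof. by rewrite /dcopair_l; cat_norm; rewrite eval_curry. Qed.

Lemma dcopair_r_inj f i (W : V) (a : Hom W A) (b : Hom W (X i)) :
  dcopair_r f ∘ pairm a (@inj V S I X i ∘ b) = f i ∘ pairm a b.
Proof.
rewrite /dcopair_r; cat_norm.
by rewrite (@dcopair_l_inj (fun i => f i ∘ pairm pr2 pr1) i W b a); cat_norm.
Qed.
End Dcopair.
End Distributivity.
Arguments dcopair_l {V L} E {S I X A Z} f.
Arguments dcopair_r {V L} E {S I X A Z} f.

Ltac cat_dcopair :=
  match goal with
  | |- context [@compm _ _ _ _ (@dcopair_l ?V ?L ?E ?S ?I ?X ?A ?Z ?f)
       (@pairm _ _ _ _ ?W (@compm _ _ _ _ (@inj _ _ _ _ ?i) ?a) ?b)] =>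
      rewrite (@dcopair_l_inj V L E S I X A Z f i W a b)
  | |- context [@compm _ _ _ _ (@dcopair_l ?V ?L ?E ?S ?I ?X ?A ?Z ?f)
       (@pairm _ _ _ _ ?W (@inj _ _ _ _ ?i) ?b)] =>
      rewrite -[@inj V S I X i]compm1
        (@dcopair_l_inj V L E S I X A Z f i W (idm _) b)
  | |- context [@compm _ _ _ _ (@dcopair_r ?V ?L ?E ?S ?I ?X ?A ?Z ?f)
       (@pairm _ _ _ _ ?W ?a (@compm _ _ _ _ (@inj _ _ _ _ ?i) ?b))] =>
      rewrite (@dcopair_r_inj V L E S I X A Z f i W a b)
  | |- context [@compm _ _ _ _ (@dcopair_r ?V ?L ?E ?S ?I ?X ?A ?Z ?f)
       (@pairm _ _ _ _ ?W ?a (@inj _ _ _ _ ?i))] =>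
      rewrite -[@inj V S I X i]compm1
        (@dcopair_r_inj V L E S I X A Z f i W a (idm _))
  end.

Ltac dcat_norm := repeat (progress cat_norm || cat_dcopair).

Section Matrices.
Context (V : Category) (L : FiniteLimits V) (E : CartesianClosed L)
  (S : SmallCoproducts V).

Definition mat (I J : SmallSet) : Type := I -> J -> V.

Definition mat_cell (I J K K' : SmallSet) (M : mat I J) (N : mat K K')
    (u : I -> K) (v : J -> K') : Type :=
  forall i j, Hom (M i j) (N (u i) (v j)).

Definition mat_comp (I J K : SmallSet) (M : mat I J) (N : mat J K) : mat I K :=
  fun i k => coprod S (fun j => prodm L (N j k) (M i j)).

Definition mat_compc (I J K I' J' K' : SmallSet) (M : mat I J) (N : mat J K)
    (M' : mat I' J') (N' : mat J' K') (u : I -> I') (v : J -> J') (w : K -> K')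
    (f : mat_cell M M' u v) (g : mat_cell N N' v w) :
    mat_cell (mat_comp M N) (mat_comp M' N') u w :=
  fun i k => copair (fun j =>
    @inj V S J' (fun j' => prodm L (N' j' (w k)) (M' (u i) j')) (v j)
      ∘ pairm (g j k ∘ pr1) (f i j ∘ pr2)).

(* The copower of [1] by the proposition [i = j]: it is [1] if [i = j], and
   initial otherwise. *)
Definition mat_id (I : SmallSet) : mat I I :=
  fun i j => coprod S (fun _ : i = j => one L).

Definition mat_idc (I K : SmallSet) (u : I -> K) :
    mat_cell (@mat_id I) (@mat_id K) u u :=
  fun i j => copair (fun e : i = j =>
    @inj V S (u i = u j) (fun _ => one L) (f_equal u e)).

Definition mat_assoc (I J K K' : SmallSet) (M : mat I J) (N : mat J K)
    (P : mat K K') :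
    mat_cell (mat_comp (mat_comp M N) P) (mat_comp M (mat_comp N P))
      (fun i => i) (fun l => l) :=
  fun i l => copair (fun k => dcopair_r E (fun j =>
    @inj V S J (fun j => prodm L (mat_comp N P j l) (M i j)) j
      ∘ pairm
          (@inj V S K (fun k => prodm L (P k l) (N j k)) k
             ∘ pairm pr1 (pr1 ∘ pr2))
          (pr2 ∘ pr2))).

Definition mat_assoc_inv (I J K K' : SmallSet) (M : mat I J) (N : mat J K)
    (P : mat K K') :
    mat_cell (mat_comp M (mat_comp N P)) (mat_comp (mat_comp M N) P)
      (fun i => i) (fun l => l) :=
  fun i l => copair (fun j => dcopair_l E (fun k =>
    @inj V S K (fun k => prodm L (P k l) (mat_comp M N i k)) k
      ∘ pairm (pr1 ∘ pr1)
          (@inj V S J (fun j => prodm L (N j k) (M i j)) j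
             ∘ pairm (pr2 ∘ pr1) pr2))).

Definition mat_unitl (I J : SmallSet) (M : mat I J) :
    mat_cell (mat_comp (@mat_id I) M) M (fun i => i) (fun j => j) :=
  fun i k => copair (fun j => dcopair_r E (fun e : i = j =>
    match e in _ = j return Hom (prodm L (M j k) (one L)) (M i k) with
    | erefl => pr1
    end)).

Definition mat_unitl_inv (I J : SmallSet) (M : mat I J) :
    mat_cell M (mat_comp (@mat_id I) M) (fun i => i) (fun j => j) :=
  fun i k =>
    @inj V S I (fun j => prodm L (M j k) (mat_id i j)) i
      ∘ pairm (idm _) (@inj V S (i = i) (fun _ => one L) erefl ∘ bang _).

Definition mat_unitr (I J : SmallSet) (M : mat I J) :
    mat_cell (mat_comp M (@mat_id J)) M (fun i => i) (fun j => j) :=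
  fun i k => copair (fun j => dcopair_l E (fun e : j = k =>
    match e in _ = k return Hom (prodm L (one L) (M i j)) (M i k) with
    | erefl => pr2
    end)).

Definition mat_unitr_inv (I J : SmallSet) (M : mat I J) :
    mat_cell M (mat_comp M (@mat_id J)) (fun i => i) (fun j => j) :=
  fun i k =>
    @inj V S J (fun j => prodm L (mat_id j k) (M i j)) k
      ∘ pairm (@inj V S (k = k) (fun _ => one L) erefl ∘ bang _) (idm _).

Lemma mat_cell_eq (I J K K' : SmallSet) (M : mat I J) (N : mat K K')
    (u : I -> K) (v : J -> K') (f g : mat_cell M N u v) :
  (forall i j, f i j = g i j) -> f = g.
Proof.
move=> fg; apply: functional_extensionality_dep => i.
by apply: functional_extensionality_dep => j.
Qed.

Lemma mat_pack_eq (I J K K' : SmallSet) (M : mat I J) (N : mat K K')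
    (u : I -> K) (v : J -> K') (f g : mat_cell M N u v) :
  (forall i j, f i j = g i j) ->
  @pack _ _ (mat_cell M N) u v f = @pack _ _ (mat_cell M N) u v g.
Proof. by move=> fg; rewrite (mat_cell_eq fg). Qed.

Ltac mat_unfold := rewrite /mat_compc /mat_idc /mat_assoc /mat_assoc_inv
  /mat_unitl /mat_unitl_inv /mat_unitr /mat_unitr_inv.

Ltac mat_start := intros; first [apply: mat_cell_eq | apply: mat_pack_eq];
  simpl; mat_unfold.

Definition Mat : PseudoDoubleCategory.
Proof.
refine (@Build_PseudoDoubleCategory SET mat mat_cell
  (fun I J M i j => idm (M i j))
  (fun _ _ _ _ _ _ M N P u v u' v' g f i j => g (u i) (v j) ∘ f i j)
  _ _ _ mat_id mat_idc _ _ mat_comp mat_compc _ _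
  mat_assoc mat_assoc_inv _ _ _ mat_unitl mat_unitl_inv _ _ _
  mat_unitr mat_unitr_inv _ _ _ _ _).
- abstract (by mat_start => i j; apply: compm1).
- abstract (by mat_start => i j; apply: comp1m).
- abstract (by mat_start => i j; apply: compmA).
- abstract (by mat_start => i j; apply: coprod_ext => e; case: j / e;
    dcat_norm).
- abstract (by mat_start => i j; apply: coprod_ext => e; case: j / e;
    dcat_norm).
- abstract (by mat_start => i k; apply: coprod_ext => j; dcat_norm).
- abstract (by mat_start => i k; apply: coprod_ext => j; dcat_norm).
- abstract (by mat_start => i l; apply: coprod_ext => k;
    apply: (jepi_r E (@jepi_inj V S _ _)) => j; dcat_norm).
- abstract (by mat_start => i l; apply: coprod_ext => j;
    apply: (jepi_l E (@jepi_inj V S _ _)) => k; dcat_norm).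
- abstract (by mat_start => i l; apply: coprod_ext => k;
    apply: (jepi_r E (@jepi_inj V S _ _)) => j; dcat_norm).
- abstract (by mat_start => i k; apply: coprod_ext => j;
    apply: (jepi_r E (@jepi_inj V S _ _)) => e; case: j / e; dcat_norm;
    congr (_ ∘ pairm _ (_ ∘ _)); apply: one_ext).
- abstract (by mat_start => i k; dcat_norm).
- abstract (by mat_start => i k; apply: coprod_ext => j;
    apply: (jepi_r E (@jepi_inj V S _ _)) => e; case: j / e; dcat_norm).
- abstract (by mat_start => i k; apply: coprod_ext => j;
    apply: (jepi_l E (@jepi_inj V S _ _)) => e; case: k / e; dcat_norm;
    congr (_ ∘ pairm (_ ∘ _) _); apply: one_ext).
- abstract (by mat_start => i k; dcat_norm).
- abstract (by mat_start => i k; apply: coprod_ext => j;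
    apply: (jepi_l E (@jepi_inj V S _ _)) => e; case: k / e; dcat_norm).
- abstract (by mat_start => i m; apply: coprod_ext => l;
    apply: (jepi_r E (@jepi_inj V S _ _)) => k;
    apply: (jepi_r E (jepi_r E (@jepi_inj V S _ _))) => j; dcat_norm).
- abstract (by mat_start => i k; apply: coprod_ext => k';
    apply: (jepi_r E (@jepi_inj V S _ _)) => j;
    apply: (jepi_r E (jepi_l E (@jepi_inj V S _ _))) => e; case: k' / e;
    dcat_norm).
Defined.
End Matrices.

Section Spans.
Context (V : Category) (L : FiniteLimits V) (S : SmallCoproducts V).
Local Notation pt := (copower1 L S).

Record span (I J : SmallSet) := {
  apex : V;
  legl : Hom apex (pt I);
  legr : Hom apex (pt J)
}.

Record span_cell (I J K K' : SmallSet) (a : span I J) (b : span K K')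
    (u : I -> K) (v : J -> K') := {
  span_map :> Hom (apex a) (apex b);
  span_mapl : legl b ∘ span_map = copower1_map L S u ∘ legl a;
  span_mapr : legr b ∘ span_map = copower1_map L S v ∘ legr a
}.

Lemma span_cell_eq (I J K K' : SmallSet) (a : span I J) (b : span K K')
    (u : I -> K) (v : J -> K') (f g : span_cell a b u v) :
  span_map f = span_map g -> f = g.
Proof.
case: f g => [f el er] [g el' er'] /= fg.
case: g / fg el' er' => el' er'.
by rewrite (proof_irrelevance _ el el') (proof_irrelevance _ er er').
Qed.

Lemma span_pack_eq (I J K K' : SmallSet) (a : span I J) (b : span K K')
    (u : I -> K) (v : J -> K') (f g : span_cell a b u v) :
  span_map f = span_map g ->
  @pack _ _ (span_cell a b) u v f = @pack _ _ (span_cell a b) u v g.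
Proof. by move=> fg; rewrite (span_cell_eq fg). Qed.

Lemma copower1_map1 (I : SmallSet) :
  copower1_map L S (fun i : I => i) = idm (pt I).
Proof. by apply: coprod_ext => i; rewrite /copower1_map; cat_norm. Qed.

Lemma copower1_mapD (I J K : SmallSet) (v : J -> K) (u : I -> J) :
  copower1_map L S (fun i => v (u i))
  = copower1_map L S v ∘ copower1_map L S u.
Proof. by apply: coprod_ext => i; rewrite /copower1_map; cat_norm. Qed.

Lemma leg_comp (A B : V) (I J K : SmallSet) (u : I -> J) (v : J -> K)
    (X : V) (l : Hom X (pt K)) (m : Hom B (pt J)) (k : Hom A (pt I))
    (f : Hom A B) (g : Hom B X) :
  l ∘ g = copower1_map L S v ∘ m -> m ∘ f = copower1_map L S u ∘ k ->
  l ∘ (g ∘ f) = copower1_map L S (fun i => v (u i)) ∘ k.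
Proof. by move=> e e'; rewrite -compmA e compmA e' (copower1_mapD v u) compmA. Qed.

Lemma leg_id (A : V) (I : SmallSet) (l k : Hom A (pt I)) :
  l = k -> l = copower1_map L S (fun i : I => i) ∘ k.
Proof. by rewrite copower1_map1 comp1m. Qed.

Definition span_id (I J : SmallSet) (a : span I J) :
  span_cell a a (fun i => i) (fun j => j).
Proof.
by exists (idm (apex a)); apply: leg_id; apply: compm1.
Defined.

Definition span_vcomp (I J K K' X Y : SmallSet) (a : span I J) (b : span K K')
  (c : span X Y) (u : I -> K) (v : J -> K') (u' : K -> X) (v' : K' -> Y)
  (g : span_cell b c u' v') (f : span_cell a b u v) :
  span_cell a c (fun i => u' (u i)) (fun j => v' (v j)).
Proof.
exists (span_map g ∘ span_map f).
- exact: leg_comp (span_mapl g) (span_mapl f).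
- exact: leg_comp (span_mapr g) (span_mapr f).
Defined.

Definition span_unit (I : SmallSet) : span I I :=
  @Build_span I I (pt I) (idm (pt I)) (idm (pt I)).

Definition span_unitc (I K : SmallSet) (u : I -> K) :
  span_cell (span_unit I) (span_unit K) u u.
Proof. by exists (copower1_map L S u); rewrite /= compm1 comp1m. Defined.

Definition span_comp (I J K : SmallSet) (a : span I J) (b : span J K) :
    span I K :=
  @Build_span I K (pullback L (legr a) (legl b)) (legl a ∘ pb1) (legr b ∘ pb2).

Lemma pb_commA (A B X Y : V) (f : Hom A X) (g : Hom B X)
    (h : Hom Y (pullback L f g)) : f ∘ (pb1 ∘ h) = g ∘ (pb2 ∘ h).
Proof. by rewrite -!compmA pb_comm. Qed.

Lemma pb_idl (A X : V) (g : Hom A X) : g ∘ @pb2 V L _ _ _ (idm X) g = pb1.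
Proof. by rewrite -pb_comm comp1m. Qed.

Lemma pb_idr (A X : V) (f : Hom A X) : f ∘ @pb1 V L _ _ _ f (idm X) = pb2.
Proof. by rewrite pb_comm comp1m. Qed.

Section SpanComp.
Context (I J K I' J' K' : SmallSet) (a : span I J) (b : span J K)
  (a' : span I' J') (b' : span J' K') (u : I -> I') (v : J -> J') (w : K -> K')
  (f : span_cell a a' u v) (g : span_cell b b' v w).

Lemma span_compcP :
  legr a' ∘ (span_map f ∘ pb1)
  = legl b' ∘ (span_map g ∘ @pb2 V L _ _ _ (legr a) (legl b)).
Proof.
by rewrite -!compmA span_mapr span_mapl !compmA pb_comm.
Qed.

Definition span_compc : span_cell (span_comp a b) (span_comp a' b') u w.
Proof.
exists (pbpair span_compcP); cat_norm.
- by rewrite -!compmA span_mapl.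
- by rewrite -!compmA span_mapr.
Defined.
End SpanComp.

Section SpanAssoc.
Context (I J K K' : SmallSet) (a : span I J) (b : span J K) (c : span K K').

Lemma span_assocP1 :
  legr b ∘ (pb2 ∘ pb1)
  = legl c ∘ @pb2 V L _ _ _ (legr (span_comp a b)) (legl c).
Proof. by rewrite -compmA; exact: pb_comm. Qed.

Lemma span_assocP2 :
  legr a ∘ (pb1 ∘ pb1) = legl (span_comp b c) ∘ pbpair span_assocP1.
Proof. by cat_norm; rewrite pb_commA. Qed.

Definition span_assoc :
  span_cell (span_comp (span_comp a b) c) (span_comp a (span_comp b c))
    (fun i => i) (fun l => l).
Proof. by exists (pbpair span_assocP2); apply: leg_id; cat_norm. Defined.

Lemma span_assoc_invP1 :
  legr a ∘ @pb1 V L _ _ _ (legr a) (legl (span_comp b c))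
  = legl b ∘ (pb1 ∘ pb2).
Proof. by rewrite pb_comm /= compmA. Qed.

Lemma span_assoc_invP2 :
  legr (span_comp a b) ∘ pbpair span_assoc_invP1 = legl c ∘ (pb2 ∘ pb2).
Proof. by cat_norm; rewrite pb_commA. Qed.

Definition span_assoc_inv :
  span_cell (span_comp a (span_comp b c)) (span_comp (span_comp a b) c)
    (fun i => i) (fun l => l).
Proof. by exists (pbpair span_assoc_invP2); apply: leg_id; cat_norm. Defined.
End SpanAssoc.

Section SpanUnit.
Context (I J : SmallSet) (a : span I J).

Definition span_unitl :
  span_cell (span_comp (span_unit I) a) a (fun i => i) (fun j => j).
Proof. by exists pb2; apply: leg_id => //=; rewrite pb_comm. Defined.

Lemma span_unitl_invP : idm (pt I) ∘ legl a = legl a ∘ idm (apex a).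
Proof. by cat_norm. Qed.

Definition span_unitl_inv :
  span_cell a (span_comp (span_unit I) a) (fun i => i) (fun j => j).
Proof. by exists (pbpair span_unitl_invP); apply: leg_id; cat_norm. Defined.

Definition span_unitr :
  span_cell (span_comp a (span_unit J)) a (fun i => i) (fun j => j).
Proof. by exists pb1; apply: leg_id => //=; rewrite -pb_comm. Defined.

Lemma span_unitr_invP : legr a ∘ idm (apex a) = idm (pt J) ∘ legr a.
Proof. by cat_norm. Qed.

Definition span_unitr_inv :
  span_cell a (span_comp a (span_unit J)) (fun i => i) (fun j => j).
Proof. by exists (pbpair span_unitr_invP); apply: leg_id; cat_norm. Defined.
End SpanUnit.

Ltac span_start :=
  intros; first [apply: span_cell_eq | apply: span_pack_eq]; simpl.

Ltac pb_norm := cat_norm; repeat (apply: pb_ext; cat_norm).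

Definition Span : PseudoDoubleCategory.
Proof.
refine (@Build_PseudoDoubleCategory SET span span_cell span_id span_vcomp
  _ _ _ span_unit span_unitc _ _ span_comp span_compc _ _
  span_assoc span_assoc_inv _ _ _ span_unitl span_unitl_inv _ _ _
  span_unitr span_unitr_inv _ _ _ _ _).
- abstract (by span_start; cat_norm).
- abstract (by span_start; cat_norm).
- abstract (by span_start; cat_norm).
- abstract (by span_start; apply: copower1_map1).
- abstract (by span_start; apply: copower1_mapD).
- abstract (by span_start; pb_norm).
- abstract (by span_start; pb_norm).
- abstract (by span_start; pb_norm).
- abstract (by span_start; pb_norm).
- abstract (by span_start; pb_norm).
- abstract (by span_start; pb_norm => //; apply: pb_idl).
- abstract (by span_start; pb_norm).
- abstract (by span_start; pb_norm).
- abstract (by span_start; pb_norm => //; apply: pb_idr).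
- abstract (by span_start; pb_norm).
- abstract (by span_start; pb_norm).
- abstract (by span_start; pb_norm).
- abstract (by span_start; pb_norm).
Defined.
End Spans.


Section IntEn.
Context (V : Category) (L : FiniteLimits V) (E : CartesianClosed L)
  (S : SmallCoproducts V).
Local Notation pt := (copower1 L S).
Local Notation MatV := (Mat E S).
Local Notation SpanV := (Span L S).

Definition int_apex (I J : SmallSet) (M : mat V I J) : V :=
  coprod S (fun p : I * J => M p.1 p.2).

Definition int_inj (I J : SmallSet) (M : mat V I J) (i : I) (j : J) :
    Hom (M i j) (int_apex M) :=
  @inj V S (I * J)%type (fun p => M p.1 p.2) (i, j).

Lemma int_ext (I J : SmallSet) (M : mat V I J) (Z : V)
    (f g : Hom (int_apex M) Z) :
  (forall i j, f ∘ int_inj M i j = g ∘ int_inj M i j) -> f = g.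
Proof. by move=> fg; apply: coprod_ext => -[i j]; apply: fg. Qed.

Definition int_copair (I J : SmallSet) (M : mat V I J) (Z : V)
    (f : forall i j, Hom (M i j) Z) : Hom (int_apex M) Z :=
  copair (fun p : I * J => f p.1 p.2).

Lemma int_copair_inj (I J : SmallSet) (M : mat V I J) (Z : V)
    (f : forall i j, Hom (M i j) Z) (i : I) (j : J) :
  int_copair f ∘ int_inj M i j = f i j.
Proof. by rewrite /int_copair /int_inj; cat_norm. Qed.

Lemma int_copair_inj_comp (I J : SmallSet) (M : mat V I J) (Z W : V)
    (f : forall i j, Hom (M i j) Z) (i : I) (j : J) (h : Hom W (M i j)) :
  int_copair f ∘ (int_inj M i j ∘ h) = f i j ∘ h.
Proof. by rewrite -compmA int_copair_inj. Qed.

Definition int_span (I J : SmallSet) (M : mat V I J) : span L S I J :=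
  @Build_span V L S I J (int_apex M)
    (int_copair (fun i j => inj i ∘ bang (M i j)))
    (int_copair (fun i j => inj j ∘ bang (M i j))).

Ltac int_norm := repeat (progress dcat_norm
  || rewrite int_copair_inj || rewrite int_copair_inj_comp).

Lemma bang_comp (A B : V) (f : Hom A B) : bang B ∘ f = @bang V L A.
Proof. exact: one_ext. Qed.

Definition int_cell (I J K K' : SmallSet) (M : mat V I J) (N : mat V K K')
  (u : I -> K) (v : J -> K') (f : mat_cell M N u v) :
  span_cell (int_span M) (int_span N) u v.
Proof.
exists (int_copair (fun i j => int_inj N (u i) (v j) ∘ f i j)).
- abstract (by apply: int_ext => i j; rewrite /copower1_map; int_norm;
    rewrite bang_comp).
- abstract (by apply: int_ext => i j; rewrite /copower1_map; int_norm;
    rewrite bang_comp).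
Defined.

Definition Int_map : DoubleMap MatV SpanV.
Proof.
refine (@Build_DoubleMap MatV SpanV (functor_id SET) int_span int_cell _ _).
- abstract (by move=> I J M; apply: span_pack_eq; apply: int_ext => i j; int_norm).
- abstract (by move=> *; apply: span_pack_eq; apply: int_ext => i j; int_norm).
Defined.

Definition int_unit (I : SmallSet) :
  span_cell (int_span (@mat_id V L S I)) (span_unit L S I)
    (fun i => i) (fun i => i).
Proof.
exists (int_copair (fun i j => copair (fun _ : i = j => inj i))).
- abstract (by apply: leg_id; apply: int_ext => i j; apply: coprod_ext => e; int_norm;
    rewrite bang_comp (one_ext (bang (one L)) (idm _)); int_norm).
- abstract (by apply: leg_id; apply: int_ext => i j; apply: coprod_ext => e; int_norm;
    rewrite bang_comp (one_ext (bang (one L)) (idm _)); int_norm;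
    rewrite e).
Defined.

Lemma int_compP (I J K : SmallSet) (M : mat V I J) (N : mat V J K)
    (i : I) (j : J) (k : K) :
  legr (int_span M) ∘ (int_inj M i j ∘ pr2)
  = legl (int_span N) ∘ (int_inj N j k ∘ @pr1 V L (N j k) (M i j)).
Proof. by int_norm; rewrite !bang_comp. Qed.

Definition int_comp (I J K : SmallSet) (M : mat V I J) (N : mat V J K) :
  span_cell (int_span (mat_comp L S M N))
    (span_comp (int_span M) (int_span N)) (fun i => i) (fun k => k).
Proof.
exists (int_copair (fun i k => copair (fun j => pbpair (int_compP M N i j k)))).
- abstract (by apply: leg_id; apply: int_ext => i k; apply: coprod_ext => j; int_norm;
    rewrite !bang_comp).
- abstract (by apply: leg_id; apply: int_ext => i k; apply: coprod_ext => j; int_norm;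
    rewrite !bang_comp).
Defined.

Definition Int : OplaxDoubleFunctor MatV SpanV.
Proof.
refine (@Build_OplaxDoubleFunctor MatV SpanV Int_map
  (@Build_OplaxStructure MatV SpanV Int_map int_unit int_comp) _ _ _ _ _).
- abstract (by move=> I J u; apply: span_pack_eq; apply: int_ext => i j;
    apply: coprod_ext => e; rewrite /= /copower1_map /mat_idc; int_norm).
- abstract (by move=> I J K I' J' K' M N M' N' u v w f g; apply: span_pack_eq;
    apply: int_ext => i k; apply: coprod_ext => j; rewrite /= /mat_compc;
    int_norm; apply: pb_ext; int_norm).
- abstract (by move=> I J K K' M N P; apply: span_pack_eq;
    apply: int_ext => i l; apply: coprod_ext => k;
    apply: (jepi_r E (@jepi_inj V S _ _)) => j; rewrite /= /mat_assoc;
    int_norm; repeat (apply: pb_ext; int_norm)).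
- abstract (by move=> I J M; apply: span_pack_eq;
    apply: int_ext => i k; apply: coprod_ext => j;
    apply: (jepi_r E (@jepi_inj V S _ _)) => e; rewrite /= /mat_unitl;
    case: j / e; int_norm).
- abstract (by move=> I J M; apply: span_pack_eq;
    apply: int_ext => i k; apply: coprod_ext => j;
    apply: (jepi_l E (@jepi_inj V S _ _)) => e; rewrite /= /mat_unitr;
    case: k / e; int_norm).
Defined.

(* The pullback of $\langle v_I, v_J\rangle$ along
   $\langle\bar\imath, \bar\jmath\rangle$ *)
Definition en_mat (I J : SmallSet) (a : span L S I J) : mat V I J :=
  fun i j => pullback L (@pairm V L (pt I) (pt J) _ (legl a) (legr a))
    (@pairm V L (pt I) (pt J) (one L) (inj i) (inj j)).

Lemma en_matP (I J : SmallSet) (a : span L S I J) (i : I) (j : J) (X : V)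
    (h : Hom X (apex a)) :
  legl a ∘ h = inj i ∘ bang X -> legr a ∘ h = inj j ∘ bang X ->
  @pairm V L (pt I) (pt J) _ (legl a) (legr a) ∘ h
  = @pairm V L (pt I) (pt J) (one L) (inj i) (inj j) ∘ bang X.
Proof. by move=> el er; cat_norm; rewrite el er. Qed.

Lemma en_mat_legl (I J : SmallSet) (a : span L S I J) (i : I) (j : J) :
  legl a ∘ pb1 = inj i ∘ bang (en_mat a i j).
Proof.
have := pb_comm L (@pairm V L (pt I) (pt J) _ (legl a) (legr a))
  (@pairm V L (pt I) (pt J) (one L) (inj i) (inj j)).
move/(congr1 (fun h => pr1 ∘ h)); rewrite -!compmA !pr1_pairm => ->.
by congr (_ ∘ _); apply: one_ext.
Qed.

Lemma en_mat_legr (I J : SmallSet) (a : span L S I J) (i : I) (j : J) :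
  legr a ∘ pb1 = inj j ∘ bang (en_mat a i j).
Proof.
have := pb_comm L (@pairm V L (pt I) (pt J) _ (legl a) (legr a))
  (@pairm V L (pt I) (pt J) (one L) (inj i) (inj j)).
move/(congr1 (fun h => pr2 ∘ h)); rewrite -!compmA !pr2_pairm => ->.
by congr (_ ∘ _); apply: one_ext.
Qed.

Lemma en_ext (I J : SmallSet) (a : span L S I J) (i : I) (j : J) (X : V)
    (f g : Hom X (en_mat a i j)) : pb1 ∘ f = pb1 ∘ g -> f = g.
Proof. by move=> fg; apply: pb_ext => //; apply: one_ext. Qed.

Section EnCell.
Context (I J K K' : SmallSet) (a : span L S I J) (b : span L S K K')
  (u : I -> K) (v : J -> K') (f : span_cell a b u v).

Lemma en_cellP (i : I) (j : J) :
  @pairm V L (pt K) (pt K') _ (legl b) (legr b) ∘ (span_map f ∘ pb1)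
  = @pairm V L (pt K) (pt K') (one L) (inj (u i)) (inj (v j))
      ∘ bang (en_mat a i j).
Proof.
apply: en_matP.
- by rewrite -compmA span_mapl compmA en_mat_legl /copower1_map; cat_norm.
- by rewrite -compmA span_mapr compmA en_mat_legr /copower1_map; cat_norm.
Qed.

Definition en_cell : mat_cell (en_mat a) (en_mat b) u v :=
  fun i j => pbpair (en_cellP i j).
End EnCell.

Definition En_map : DoubleMap SpanV MatV.
Proof.
refine (@Build_DoubleMap SpanV MatV (functor_id SET) en_mat en_cell _ _).
- abstract (by move=> I J a; apply: mat_pack_eq => i j; apply: en_ext; rewrite /en_cell;
    cat_norm).
- abstract (by move=> *; apply: mat_pack_eq => i j; apply: en_ext; rewrite /en_cell;
    cat_norm).
Defined.

Lemma en_unitP (I : SmallSet) (i j : I) (e : i = j) :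
  @pairm V L (pt I) (pt I) _ (legl (span_unit L S I)) (legr (span_unit L S I))
    ∘ inj i
  = @pairm V L (pt I) (pt I) (one L) (inj i) (inj j) ∘ bang (one L).
Proof.
apply: en_matP; rewrite /= comp1m (one_ext (bang (one L)) (idm _)) compm1 //.
by rewrite e.
Qed.

Definition en_unit (I : SmallSet) :
    mat_cell (@mat_id V L S I) (en_mat (span_unit L S I))
      (fun i => i) (fun i => i) :=
  fun i j => copair (fun e : i = j => pbpair (en_unitP e)).

Section EnComp.
Context (I J K : SmallSet) (a : span L S I J) (b : span L S J K)
  (i : I) (j : J) (k : K).

Lemma en_compP1 :
  legr a ∘ (pb1 ∘ pr2)
  = legl b ∘ (pb1 ∘ @pr1 V L (en_mat b j k) (en_mat a i j)).
Proof.
rewrite -!compmA en_mat_legr en_mat_legl !compmA.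
by congr (_ ∘ _); apply: one_ext.
Qed.

Lemma en_compP2 :
  @pairm V L (pt I) (pt K) _ (legl (span_comp a b)) (legr (span_comp a b))
    ∘ pbpair en_compP1
  = @pairm V L (pt I) (pt K) (one L) (inj i) (inj k) ∘ bang _.
Proof.
apply: en_matP; cat_norm; rewrite -compmA ?en_mat_legl ?en_mat_legr compmA;
  by congr (_ ∘ _); apply: one_ext.
Qed.
End EnComp.

Definition en_comp (I J K : SmallSet) (a : span L S I J) (b : span L S J K) :
    mat_cell (mat_comp L S (en_mat a) (en_mat b)) (en_mat (span_comp a b))
      (fun i => i) (fun k => k) :=
  fun i k => copair (fun j => pbpair (en_compP2 a b i j k)).

Definition En : LaxDoubleFunctor SpanV MatV.
Proof.
refine (@Build_LaxDoubleFunctor SpanV MatV En_map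
  (@Build_LaxStructure SpanV MatV En_map en_unit en_comp) _ _ _ _ _).
- abstract (by move=> I J u; apply: mat_pack_eq => i j; apply: coprod_ext => e;
    apply: en_ext; rewrite /= /en_unit /en_cell /mat_idc; cat_norm;
    rewrite /copower1_map; cat_norm).
- abstract (by move=> I J K I' J' K' a b a' b' u v w f g; apply: mat_pack_eq => i k;
    apply: coprod_ext => j;
    apply: en_ext; rewrite /= /en_comp /en_cell /mat_compc; cat_norm;
    apply: pb_ext; cat_norm).
- abstract (by move=> I J K K' a b c; apply: mat_pack_eq => i l;
    apply: coprod_ext => k; apply: (jepi_r E (@jepi_inj V S _ _)) => j;
    apply: en_ext; rewrite /= /en_comp /en_cell /mat_compc /mat_assoc; dcat_norm;
    repeat (apply: pb_ext; dcat_norm)).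
- abstract (by move=> I J a; apply: mat_pack_eq => i k;
    apply: coprod_ext => j; apply: (jepi_r E (@jepi_inj V S _ _)) => e;
    apply: en_ext;
    rewrite /= /en_comp /en_cell /en_unit /mat_compc /mat_unitl;
    case: j / e; dcat_norm).
- abstract (by move=> I J a; apply: mat_pack_eq => i k;
    apply: coprod_ext => j; apply: (jepi_l E (@jepi_inj V S _ _)) => e;
    apply: en_ext;
    rewrite /= /en_comp /en_cell /en_unit /mat_compc /mat_unitr;
    case: k / e; dcat_norm).
Defined.
End IntEn.

(* Main.v *)
(* Call [y : Y -> A] a fibre of [p : A -> I . 1] over [i] when it is the
   pullback of [p] along the [i]-th coprojection.  Every condition is equivalent
   to the conjunction of
   (U) each coprojection [X i -> coprod X] is a fibre of [coprod X -> I . 1],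
   (C) the fibres of any [p : A -> I . 1] exhibit [A] as their coproduct.
   (U) and (C) are the invertibility of the unit and of the counit in (1);
   pasting pullbacks extends them to fibres over the summands of an arbitrary
   coproduct, which is (2).  On 2-cells, Int is left adjoint to En over the
   identity of sets.  A span from I to J is an object over [(I * J) . 1], since
   [(I * J) . 1] is the product of [I . 1] and [J . 1] by cartesian closedness,
   so under (U) and (C) the unit and counit of this adjunction, and likewise the
   comparison cells of Int and En, are invertible, giving (3) and (4).
   Conversely, if Int or En is an equivalence then the unit and counit are
   invertible, and the case J = 1 gives back (U) and (C). *)
From Stdlib Require Import FunctionalExtensionality ProofIrrelevance.
From Stdlib Require Import IndefiniteDescription.
From mathcomp Require Import ssreflect ssrfun ssrbool.
Require Import Defs.

Set Implicit Arguments.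
Unset Strict Implicit.
Unset Printing Implicit Defensive.

Local Open Scope cat_scope.

(** * Choice, isomorphisms and commutative squares *)

Lemma dependent_choice_fun (I : Type) (T : I -> Type)
    (P : forall i, T i -> Prop) :
  (forall i, exists x, P i x) -> exists f : forall i, T i, forall i, P i (f i).
Proof.
move=> ex.
exists (fun i => proj1_sig (constructive_indefinite_description _ (ex i))) => i.
exact: proj2_sig (constructive_indefinite_description _ (ex i)).
Qed.

Section CategoryTheory.
Context (C : Category).

Lemma iso_monic (A B X : C) (m : Hom A B) (f g : Hom X A) :
  is_iso m -> m ∘ f = m ∘ g -> f = g.
Proof.
move=> [n [nm _]] /(congr1 (fun h => n ∘ h)).
by rewrite -!compmA nm !comp1m.
Qed.

Lemma iso_epic (A B X : C) (m : Hom A B) (f g : Hom B X) :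
  is_iso m -> f ∘ m = g ∘ m -> f = g.
Proof.
move=> [n [_ mn]] /(congr1 (fun h => h ∘ n)).
by rewrite !compmA mn !compm1.
Qed.

Lemma iso_of_section (A B : C) (m : Hom A B) (r : Hom B A) :
  is_iso m -> r ∘ m = idm A -> is_iso r.
Proof.
move=> mi rm; exists m; split=> //.
by apply: (iso_epic mi); rewrite compmA rm compm1 comp1m.
Qed.

Lemma iso_of_retraction (A B : C) (m : Hom A B) (r : Hom B A) :
  is_iso r -> r ∘ m = idm A -> is_iso m.
Proof.
move=> ri rm; exists r; split=> //.
by apply: (iso_monic ri); rewrite -compmA rm compm1 comp1m.
Qed.

Lemma iso_conj (A B A' B' : C) (m : Hom A B) (n : Hom A' B')
    (a : Hom A A') (b : Hom B B') :
  is_iso a -> is_iso b -> b ∘ m = n ∘ a -> is_iso m -> is_iso n.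
Proof.
move=> ai bi; case: (ai) => a' [a'a aa']; case: (bi) => b' [b'b bb'].
move=> sq [m' [m'm mm']]; exists (a ∘ m' ∘ b'); split.
  apply: (iso_epic ai); rewrite comp1m !compmA -sq -(compmA b' b m) b'b comp1m.
  by rewrite m'm compm1.
by rewrite -!compmA -sq (compmA b m m') mm' compm1 bb'.
Qed.

(** Two opposite sides of a commutative square are reversed at the cost of one one-sided inverse
    each. Applied to 2-cells, this turns naturality and associativity of comparison cells into the
    same laws for their inverses. *)
Lemma square_inverse (A B A' B' : C) (f : Hom A B) (f' : Hom A' B')
    (a : Hom B B') (b : Hom A A') (g : Hom B A) (g' : Hom B' A') :
  a ∘ f = f' ∘ b -> f ∘ g = idm B -> g' ∘ f' = idm A' -> b ∘ g = g' ∘ a.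
Proof.
move=> sq fg gf'.
by rewrite -(compm1 a) -fg -(compmA a) sq -!compmA gf' comp1m.
Qed.

Lemma inverse_unique (A B : C) (f : Hom A B) (g h : Hom B A) :
  g ∘ f = idm A -> f ∘ h = idm B -> g = h.
Proof. by move=> gf fh; rewrite -(compm1 g) -fh -compmA gf comp1m. Qed.

Lemma shift_inverse (A B D : C) (f : Hom A B) (g : Hom B A)
    (a : Hom B D) (b : Hom A D) :
  a ∘ f = b -> f ∘ g = idm B -> b ∘ g = a.
Proof. by move=> <- fg; rewrite compmA fg compm1. Qed.

Lemma comp_inverse (A B D : C) (f : Hom A B) (f' : Hom B D)
    (g : Hom B A) (g' : Hom D B) :
  g ∘ f = idm A -> g' ∘ f' = idm B -> (g ∘ g') ∘ (f' ∘ f) = idm A.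
Proof. by move=> gf gf'; rewrite compmA -(compmA g') gf' comp1m. Qed.

Section Mates.
Context (P Q R : C).

Lemma cancel_left (f : Hom Q R) (g : Hom R Q) (a : Hom P Q) (b : Hom P R) :
  g ∘ f = idm Q -> f ∘ a = b -> a = g ∘ b.
Proof. by move=> gf <-; rewrite -compmA gf comp1m. Qed.

Lemma cancel_right (f : Hom P Q) (g : Hom Q P) (a : Hom Q R) (b : Hom P R) :
  f ∘ g = idm Q -> a ∘ f = b -> a = b ∘ g.
Proof. by move=> fg <-; rewrite compmA fg compm1. Qed.

(** In a mate condition [p ∘ h = q ∘ e], the comparison cells are [p] and [q], and the
    transformation provides [h] and [e]. Solving for [h'] gives the compatibility of the inverse
    transformation. *)
Lemma mate_inverse_left (X : C) (h : Hom Q R) (p : Hom R X) (e : Hom Q P)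
    (q : Hom P X) (h' : Hom R Q) (e' : Hom P Q) (q' : Hom X P) :
  p ∘ h = q ∘ e -> h ∘ h' = idm R -> e' ∘ e = idm Q -> q' ∘ q = idm P ->
  h' = e' ∘ (q' ∘ p).
Proof.
move=> sq hh ee qq.
rewrite -[p]compm1 -hh -(compmA p) sq -!compmA (compmA e') qq compm1.
by rewrite ee comp1m.
Qed.

Lemma mate_inverse_right (X : C) (f : Hom P Q) (h : Hom Q R) (w : Hom P X)
    (e : Hom X R) (f' : Hom Q P) (h' : Hom R Q) (e' : Hom R X) :
  h ∘ f = e ∘ w -> f ∘ f' = idm Q -> h ∘ h' = idm R -> e' ∘ e = idm X ->
  (w ∘ f') ∘ h' = e'.
Proof.
move=> sq ff hh ee.
rewrite -[w]comp1m -ee (compmA e') -sq !compmA -(compmA f) ff comp1m.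
by rewrite hh compm1.
Qed.
End Mates.

End CategoryTheory.

Lemma prod_iso (I : SmallSet) (C : I -> Category) (A B : prod_cat C)
    (f : Hom A B) :
  is_iso f <-> forall i, is_iso (f i : @Hom (C i) (A i) (B i)).
Proof.
split=> [[g [gf fg]] i|fi].
  have ev (X : prod_cat C) (h h' : Hom X X) : h = h' -> h i = h' i by move=> ->.
  by exists (g i); split; [apply: ev gf|apply: ev fg].
have [g gP] := dependent_choice_fun fi.
exists g; split; apply: functional_extensionality_dep => i;
  by case: (gP i).
Qed.

Lemma slice_iso (C : Category) (X : C) (A B : slice X) (f : Hom A B) :
  is_iso f <-> is_iso (sval f).
Proof.
split=> [[g [gf fg]]|[g [gf fg]]].
  have ev (Y : slice X) (h h' : Hom Y Y) : h = h' -> sval h = sval h'.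
    by move=> ->.
  by exists (sval g); split; [apply: ev gf|apply: ev fg].
have gP : slice_map A ∘ g = slice_map B.
  by rewrite -(svalP f) compmA fg compm1.
by exists (exist _ g gP); split; apply: slice_hom_eq.
Qed.

(** * Equivalences of categories and adjoint equivalences *)

Definition fully_faithful (C D : Category) (F : Functor C D) : Prop :=
  forall (A B : C) (h : Hom (F A) (F B)), exists! f : Hom A B, fmap F f = h.

Definition essentially_surjective (C D : Category) (F : Functor C D) : Prop :=
  forall B : D, exists (A : C) (f : Hom (F A) B), is_iso f.

Lemma fmap_iso (C D : Category) (F : Functor C D) (A B : C) (f : Hom A B) :
  is_iso f -> is_iso (fmap F f).
Proof.
by move=> [g [gf fg]]; exists (fmap F g); rewrite -!fmapD gf fg !fmap1.
Qed.

Lemma fully_faithful_inj (C D : Category) (F : Functor C D) (A B : C)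
    (f g : Hom A B) : fully_faithful F -> fmap F f = fmap F g -> f = g.
Proof.
move=> Fff fg; case: (Fff _ _ (fmap F g)) => k [_ kU].
by rewrite -(kU f fg) (kU g).
Qed.

(** No triangle identity links [eta] and [eps]. The preimage of [h] is the conjugate of [fmap G h]
    by [eta], and it is checked after applying [G], which is faithful because [eps] is
    invertible. *)
Lemma equivalence_fully_faithful (C D : Category) (F : Functor C D) :
  is_equivalence F -> fully_faithful F.
Proof.
move=> [G [eta [eps [etaI epsI]]]].
have Ff (A B : C) (f g : Hom A B) : fmap F f = fmap F g -> f = g.
  move=> e; apply: (iso_monic (etaI B)).
  by rewrite -(nt_nat eta f) -(nt_nat eta g) /= e.
have Gf (A B : D) (f g : Hom A B) : fmap G f = fmap G g -> f = g.
  move=> e; apply: (iso_epic (epsI A)).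
  by move: (nt_nat eps f) (nt_nat eps g) => /= -> ->; rewrite e.
move=> A B h; case: (etaI B) => n [ne en].
exists (n ∘ (fmap G h ∘ eta A)); split=> [|f fh]; last first.
  by rewrite -fh; move: (nt_nat eta f) => /= ->; rewrite -compmA ne comp1m.
apply: Gf; apply: (iso_epic (etaI A)).
move: (nt_nat eta (n ∘ (fmap G h ∘ eta A))) => /= ->.
by rewrite -compmA en comp1m.
Qed.

Lemma equivalence_essentially_surjective (C D : Category) (F : Functor C D) :
  is_equivalence F -> essentially_surjective F.
Proof.
by move=> [G [eta [eps [_ epsI]]]] B; exists (G B), (eps B); apply: epsI.
Qed.

Section AdjointEquivalence.
Context (C D : Category) (L : Functor C D) (R : Functor D C)
  (adj : Adjunction L R).

(** The inverse of the unit at [A] is the preimage under [L] of the counit at [L A]. The triangle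
    identity then inverts the counit on the image of [L], and naturality carries this along
    isomorphisms to every object. *)
Lemma left_adjoint_equivalence :
  fully_faithful L -> essentially_surjective L -> is_adjoint_equivalence adj.
Proof.
move=> Lf Ls.
have unitI : nat_iso (adj_unit adj).
  move=> A; have [h [hE _]] := Lf _ _ (adj_counit adj (L A)).
  exists h; split.
    by apply: (fully_faithful_inj Lf); rewrite fmapD hE fmap1 adj_triangleL.
  have := nt_nat (adj_unit adj) h => /= <-.
  by rewrite hE adj_triangleR.
split=> // B; have [A [f fI]] := Ls B.
have LRfI := fmap_iso L (fmap_iso R fI).
apply: (iso_conj LRfI fI _ (m := adj_counit adj (L A))).
  exact: (nt_nat (adj_counit adj) f).
exact: iso_of_section (fmap_iso L (unitI A)) (adj_triangleL adj A).
Qed.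

Lemma right_adjoint_equivalence :
  fully_faithful R -> essentially_surjective R -> is_adjoint_equivalence adj.
Proof.
move=> Rf Rs.
have counitI : nat_iso (adj_counit adj).
  move=> B; have [h [hE _]] := Rf _ _ (adj_unit adj (R B)).
  exists h; split.
    have := nt_nat (adj_counit adj) h => /= ->.
    by rewrite hE adj_triangleL.
  by apply: (fully_faithful_inj Rf); rewrite fmapD hE fmap1 adj_triangleR.
split=> // A; have [B [f fI]] := Rs A.
have RLfI := fmap_iso R (fmap_iso L fI).
apply: (iso_conj fI RLfI _ (m := adj_unit adj (R B))).
  exact: (nt_nat (adj_unit adj) f).
exact: iso_of_retraction (fmap_iso R (counitI B)) (adj_triangleR adj B).
Qed.

End AdjointEquivalence.

(** * Invertible 2-cells and comparison cells *)

Section Cells.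
Context (D : PseudoDoubleCategory).

Lemma pack_ccast (A B A' B' : D) (M : Hor A B) (N : Hor A' B') u u' v v'
    (eu : u = u') (ev : v = v') (f : Cell M N u v) : ccast eu ev f ≡ f.
Proof. by case: u' / eu; case: v' / ev. Qed.

(** Replaces an equation in the total space by a transport along equalities of the boundaries, which
    can then be eliminated. The predicate [T] makes this an instance of rewriting along the packed
    equation. *)
Lemma pack_eq_ccast (A B A' B' : D) (M : Hor A B) (N : Hor A' B') u u' v v'
    (f : Cell M N u v) (g : Cell M N u' v') :
  f ≡ g -> exists (eu : u = u') (ev : v = v'), ccast eu ev f = g.
Proof.
move=> fg.
pose T (x : {u : Hom A A' & {v : Hom B B' & Cell M N u v}}) :=
  exists (eu : u = projT1 x) (ev : v = projT1 (projT2 x)),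
    ccast eu ev f = projT2 (projT2 x).
by change (T (pack g)); rewrite -fg; exists erefl, erefl.
Qed.

Lemma pack_inj (A B A' B' : D) (M : Hor A B) (N : Hor A' B') u v
    (f g : Cell M N u v) : f ≡ g -> f = g.
Proof.
move=> /pack_eq_ccast [eu [ev <-]].
by rewrite (proof_irrelevance _ eu erefl) (proof_irrelevance _ ev erefl).
Qed.

Lemma pack_hcompc (A B X A' B' X' : D) (M : Hor A B) (N : Hor B X)
    (M' : Hor A' B') (N' : Hor B' X') u v w u' v' w'
    (f : Cell M M' u v) (g : Cell N N' v w)
    (f' : Cell M M' u' v') (g' : Cell N N' v' w') :
  f ≡ f' -> g ≡ g' -> hcompc f g ≡ hcompc f' g'.
Proof.
move=> /pack_eq_ccast [eu [ev <-]] /pack_eq_ccast [ev1 [ew <-]].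
(* Both equations yield a proof that the shared middle boundaries agree; the two proofs must be
   identified before either is eliminated. *)
rewrite (proof_irrelevance _ ev1 ev) => {f' g' ev1}.
by case: u' / eu; case: v' / ev; case: w' / ew.
Qed.

Lemma hcompc_inverse (A B X A' B' X' : D) (M : Hor A B) (N : Hor B X)
    (M' : Hor A' B') (N' : Hor B' X') u v w u' v' w'
    (f : Cell M M' u v) (g : Cell N N' v w)
    (f' : Cell M' M u' v') (g' : Cell N' N v' w') :
  ccomp f' f ≡ cid M -> ccomp g' g ≡ cid N ->
  ccomp (hcompc f' g') (hcompc f g) ≡ cid (hcomp M N).
Proof. by move=> ef eg; rewrite -hcompcD -hcompc1; apply: pack_hcompc. Qed.

Lemma pack_cid_ccomp (A B : D) (M : Hor A B) : ccomp (cid M) (cid M) ≡ cid M.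
Proof. exact: ccomp1. Qed.

Record hor_ob := { hor_src : D; hor_tgt : D; hor_arr : Hor hor_src hor_tgt }.

(** Here horizontal arrows are the objects and 2-cells with arbitrary vertical boundary are the
    morphisms. The relation [≡] becomes equality of morphisms, so that lemmas on ordinary categories
    apply to 2-cells. *)
Definition cell_cat : Category.
Proof.
refine (@Build_Category hor_ob
  (fun M N => {u : Hom (hor_src M) (hor_src N) &
    {v : Hom (hor_tgt M) (hor_tgt N) & Cell (hor_arr M) (hor_arr N) u v}})
  (fun M => pack (cid (hor_arr M)))
  (fun _ _ _ g f => pack (ccomp (projT2 (projT2 g)) (projT2 (projT2 f))))
  _ _ _).
- by move=> M N [u [v f]]; apply: ccomp1.
- by move=> M N [u [v f]]; apply: ccomp1l.
- by move=> M N P Q [u [v h]] [u' [v' g]] [u'' [v'' f]]; apply: ccompA.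
Defined.

Definition harrow (A B : D) (M : Hor A B) : cell_cat :=
  @Build_hor_ob A B M.

Definition packed (A B A' B' : D) (M : Hor A B) (N : Hor A' B') u v
    (f : Cell M N u v) : @Hom cell_cat (harrow M) (harrow N) := pack f.

Lemma cell_iso_packed (A B A' B' : D) (M : Hor A B) (N : Hor A' B') u v
    (f : Cell M N u v) : cell_iso f <-> is_iso (packed f).
Proof.
split=> [[u' [v' [g [gf fg]]]]|[[u' [v' g]] [gf fg]]].
  by exists (packed g).
by exists u', v', g.
Qed.

(** The inverse in [cell_iso] may have any vertical boundary. Projecting [ccomp g f ≡ cid M] to the
    boundaries forces identities, up to a cast. *)
Lemma globular_inverse (A B : D) (M N : Hor A B)
    (f : Cell M N (idm A) (idm B)) :
  cell_iso f -> exists g : Cell N M (idm A) (idm B),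
    ccomp g f ≡ cid M /\ ccomp f g ≡ cid N.
Proof.
move=> [u [v [g [gf fg]]]].
have eu : u = idm A by have := congr1 (@projT1 _ _) gf; rewrite /= compm1.
have ev : v = idm B.
  have := congr1 (fun x => projT1 (projT2 x)) gf.
  by rewrite /= compm1.
exists (ccast eu ev g); split.
  by rewrite -gf; apply: pack_ccomp => //; apply: pack_ccast.
by rewrite -fg; apply: pack_ccomp => //; apply: pack_ccast.
Qed.

(** Invertibility is a proposition while comparison cells are data, hence the choice of an
    inverse. *)
Definition globular_inv (A B : D) (M N : Hor A B)
    (f : Cell M N (idm A) (idm B)) (fI : cell_iso f) :
    Cell N M (idm A) (idm B) :=
  sval (constructive_indefinite_description _ (globular_inverse fI)).

Lemma globular_invK (A B : D) (M N : Hor A B)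
    (f : Cell M N (idm A) (idm B)) (fI : cell_iso f) :
  ccomp (globular_inv fI) f ≡ cid M.
Proof.
by case: (svalP (constructive_indefinite_description _ (globular_inverse fI))).
Qed.

Lemma globular_invKr (A B : D) (M N : Hor A B)
    (f : Cell M N (idm A) (idm B)) (fI : cell_iso f) :
  ccomp f (globular_inv fI) ≡ cid N.
Proof.
by case: (svalP (constructive_indefinite_description _ (globular_inverse fI))).
Qed.

Lemma globular_inv_iso (A B : D) (M N : Hor A B)
    (f : Cell M N (idm A) (idm B)) (fI : cell_iso f) :
  cell_iso (globular_inv fI).
Proof.
exists (idm A), (idm B), f.
by split; [apply: globular_invKr|apply: globular_invK].
Qed.

End Cells.

(** * Inverting the comparison cells of a pseudo double functor *)

Section InvertLax.
Context (D E : PseudoDoubleCategory) (F : LaxDoubleFunctor D E)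
  (FP : lax_is_pseudo F).
Local Notation u A := (lax_unit (lstr F) A).
Local Notation c M N := (lax_comp (lstr F) M N).
Let ui A := globular_inv (FP.1 A).
Let ci (A B C : D) (M : Hor A B) (N : Hor B C) :=
  globular_inv (FP.2 A B C M N).

(** Each oplax axiom is the lax axiom with its composites of comparison cells inverted: naturality
    and associativity are squares with two opposite sides reversed, and the unit laws are triangles
    with one side reversed. *)
Definition oplax_of_pseudo : OplaxDoubleFunctor D E.
Proof.
refine (@Build_OplaxDoubleFunctor D E F
  (@Build_OplaxStructure D E F ui ci) _ _ _ _ _).
- move=> A A' v.
  apply: (@square_inverse (cell_cat E) _ _ _ _ (packed (u A))
    (packed (u A')) (packed (dcell F (hidc v)))
    (packed (hidc (fmap F v))) (packed (ui A)) (packed (ui A'))).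
  + exact: lax_unit_nat.
  + exact: globular_invKr.
  + exact: globular_invK.
- move=> A B C A' B' C' M N M' N' a b d f g.
  apply: (@square_inverse (cell_cat E) _ _ _ _ (packed (c M N))
    (packed (c M' N')) (packed (dcell F (hcompc f g)))
    (packed (hcompc (dcell F f) (dcell F g))) (packed (ci M N))
    (packed (ci M' N'))).
  + exact: lax_comp_nat.
  + exact: globular_invKr.
  + exact: globular_invK.
- move=> A B C X M N P; rewrite -ccompA; apply: esym.
  apply: (@square_inverse (cell_cat E) _ _ _ _
    (packed (ccomp (c (hcomp M N) P) (hcompc (c M N) (cid (dhor F P)))))
    (packed (ccomp (c M (hcomp N P)) (hcompc (cid (dhor F M)) (c N P))))
    (packed (dcell F (hassoc M N P)))
    (packed (hassoc (dhor F M) (dhor F N) (dhor F P)))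
    (packed (ccomp (hcompc (ci M N) (cid (dhor F P))) (ci (hcomp M N) P)))
    (packed (ccomp (hcompc (cid (dhor F M)) (ci N P)) (ci M (hcomp N P))))).
  + exact: etrans (lax_assoc F M N P) (esym (ccompA _ _ _)).
  + apply: (@comp_inverse (cell_cat E) _ _ _ (packed (ci (hcomp M N) P))
      (packed (hcompc (ci M N) (cid (dhor F P)))) (packed (c (hcomp M N) P))
      (packed (hcompc (c M N) (cid (dhor F P))))).
      exact: globular_invKr.
    by apply: hcompc_inverse; [apply: globular_invKr|apply: pack_cid_ccomp].
  + apply: (@comp_inverse (cell_cat E) _ _ _
      (packed (hcompc (cid (dhor F M)) (c N P))) (packed (c M (hcomp N P)))
      (packed (hcompc (cid (dhor F M)) (ci N P))) (packed (ci M (hcomp N P)))).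
      by apply: hcompc_inverse; [apply: pack_cid_ccomp|apply: globular_invK].
    exact: globular_invK.
- move=> A B M.
  apply: (@shift_inverse (cell_cat E) _ _ _
    (packed (ccomp (c (hid A) M) (hcompc (u A) (cid (dhor F M)))))
    (packed (ccomp (hcompc (ui A) (cid (dhor F M))) (ci (hid A) M)))
    (packed (dcell F (hunitl M))) (packed (hunitl (dhor F M)))).
    exact: lax_unitl.
  apply: (@comp_inverse (cell_cat E) _ _ _ (packed (ci (hid A) M))
    (packed (hcompc (ui A) (cid (dhor F M)))) (packed (c (hid A) M))
    (packed (hcompc (u A) (cid (dhor F M))))).
    exact: globular_invKr.
  by apply: hcompc_inverse; [apply: globular_invKr|apply: pack_cid_ccomp].
- move=> A B M.
  apply: (@shift_inverse (cell_cat E) _ _ _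
    (packed (ccomp (c M (hid B)) (hcompc (cid (dhor F M)) (u B))))
    (packed (ccomp (hcompc (cid (dhor F M)) (ui B)) (ci M (hid B))))
    (packed (dcell F (hunitr M))) (packed (hunitr (dhor F M)))).
    exact: lax_unitr.
  apply: (@comp_inverse (cell_cat E) _ _ _ (packed (ci M (hid B)))
    (packed (hcompc (cid (dhor F M)) (ui B))) (packed (c M (hid B)))
    (packed (hcompc (cid (dhor F M)) (u B)))).
    exact: globular_invKr.
  by apply: hcompc_inverse; [apply: pack_cid_ccomp|apply: globular_invKr].
Defined.

Lemma oplax_of_pseudoP : oplax_is_pseudo oplax_of_pseudo.
Proof. by split=> *; apply: globular_inv_iso. Qed.
End InvertLax.

Section InvertOplax.
Context (D E : PseudoDoubleCategory) (F : OplaxDoubleFunctor D E)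
  (FP : oplax_is_pseudo F).
Local Notation u A := (oplax_unit (ostr F) A).
Local Notation c M N := (oplax_comp (ostr F) M N).
Let ui A := globular_inv (FP.1 A).
Let ci (A B C : D) (M : Hor A B) (N : Hor B C) :=
  globular_inv (FP.2 A B C M N).

Definition lax_of_pseudo : LaxDoubleFunctor D E.
Proof.
refine (@Build_LaxDoubleFunctor D E F
  (@Build_LaxStructure D E F ui ci) _ _ _ _ _).
- move=> A A' v.
  apply: (@square_inverse (cell_cat E) _ _ _ _ (packed (u A))
    (packed (u A')) (packed (hidc (fmap F v)))
    (packed (dcell F (hidc v))) (packed (ui A)) (packed (ui A'))).
  + exact: oplax_unit_nat.
  + exact: globular_invKr.
  + exact: globular_invK.
- move=> A B C A' B' C' M N M' N' a b d f g.
  apply: (@square_inverse (cell_cat E) _ _ _ _ (packed (c M N))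
    (packed (c M' N')) (packed (hcompc (dcell F f) (dcell F g)))
    (packed (dcell F (hcompc f g))) (packed (ci M N)) (packed (ci M' N'))).
  + exact: oplax_comp_nat.
  + exact: globular_invKr.
  + exact: globular_invK.
- move=> A B C X M N P; rewrite -[RHS]ccompA.
  apply: (@square_inverse (cell_cat E) _ _ _ _
    (packed (ccomp (hcompc (c M N) (cid (dhor F P))) (c (hcomp M N) P)))
    (packed (ccomp (hcompc (cid (dhor F M)) (c N P)) (c M (hcomp N P))))
    (packed (hassoc (dhor F M) (dhor F N) (dhor F P)))
    (packed (dcell F (hassoc M N P)))
    (packed (ccomp (ci (hcomp M N) P) (hcompc (ci M N) (cid (dhor F P)))))
    (packed (ccomp (ci M (hcomp N P)) (hcompc (cid (dhor F M)) (ci N P))))).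
  + exact: etrans (esym (oplax_assoc F M N P)) (esym (ccompA _ _ _)).
  + apply: (@comp_inverse (cell_cat E) _ _ _
      (packed (hcompc (ci M N) (cid (dhor F P)))) (packed (ci (hcomp M N) P))
      (packed (hcompc (c M N) (cid (dhor F P)))) (packed (c (hcomp M N) P))).
      by apply: hcompc_inverse; [apply: globular_invKr|apply: pack_cid_ccomp].
    exact: globular_invKr.
  + apply: (@comp_inverse (cell_cat E) _ _ _ (packed (c M (hcomp N P)))
      (packed (hcompc (cid (dhor F M)) (c N P))) (packed (ci M (hcomp N P)))
      (packed (hcompc (cid (dhor F M)) (ci N P)))).
      exact: globular_invK.
    by apply: hcompc_inverse; [apply: pack_cid_ccomp|apply: globular_invK].
- move=> A B M.
  apply: (@shift_inverse (cell_cat E) _ _ _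
    (packed (ccomp (hcompc (u A) (cid (dhor F M))) (c (hid A) M)))
    (packed (ccomp (ci (hid A) M) (hcompc (ui A) (cid (dhor F M)))))
    (packed (hunitl (dhor F M))) (packed (dcell F (hunitl M)))).
    exact: oplax_unitl.
  apply: (@comp_inverse (cell_cat E) _ _ _
    (packed (hcompc (ui A) (cid (dhor F M)))) (packed (ci (hid A) M))
    (packed (hcompc (u A) (cid (dhor F M)))) (packed (c (hid A) M))).
    by apply: hcompc_inverse; [apply: globular_invKr|apply: pack_cid_ccomp].
  exact: globular_invKr.
- move=> A B M.
  apply: (@shift_inverse (cell_cat E) _ _ _
    (packed (ccomp (hcompc (cid (dhor F M)) (u B)) (c M (hid B))))
    (packed (ccomp (ci M (hid B)) (hcompc (cid (dhor F M)) (ui B))))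
    (packed (hunitr (dhor F M))) (packed (dcell F (hunitr M)))).
    exact: oplax_unitr.
  apply: (@comp_inverse (cell_cat E) _ _ _
    (packed (hcompc (cid (dhor F M)) (ui B))) (packed (ci M (hid B)))
    (packed (hcompc (cid (dhor F M)) (u B))) (packed (c M (hid B)))).
    by apply: hcompc_inverse; [apply: pack_cid_ccomp|apply: globular_invKr].
  exact: globular_invKr.
Defined.

Lemma lax_of_pseudoP : lax_is_pseudo lax_of_pseudo.
Proof. by split=> *; apply: globular_inv_iso. Qed.
End InvertOplax.

(** * The inverse of an invertible vertical transformation *)

Section InverseTransformation.
Context (D E : PseudoDoubleCategory) (F G : DoubleMap D E) (a : VTrans F G)
  (aI : vt_iso a).

Let b0 A := constructive_indefinite_description _ (aI.1 A).

(** The inverse cells come with boundaries of their own. Uniqueness of inverses identifies these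
    with the chosen inverses of the vertical components, as a vertical transformation requires. *)
Lemma vt1_inverse (A B : D) (M : Hor A B) :
  exists g : Cell (dhor G M) (dhor F M) (sval (b0 A)) (sval (b0 B)),
    ccomp g (vt1 a M) ≡ cid (dhor F M) /\ ccomp (vt1 a M) g ≡ cid (dhor G M).
Proof.
have [u [v [g [ga ag]]]] := aI.2 A B M.
have inv_eq (X : D) (w : Hom (G X) (F X)) : w ∘ a X = idm _ -> w = sval (b0 X).
  by move=> wa; have [_ ab] := svalP (b0 X); exact: inverse_unique wa ab.
have eu : u = sval (b0 A) by have := congr1 (@projT1 _ _) ga; apply: inv_eq.
have ev : v = sval (b0 B).
  by have := congr1 (fun x => projT1 (projT2 x)) ga; apply: inv_eq.
exists (ccast eu ev g); split.
  by rewrite -ga; apply: pack_ccomp => //; apply: pack_ccast.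
by rewrite -ag; apply: pack_ccomp => //; apply: pack_ccast.
Qed.

Let b1 (A B : D) (M : Hor A B) :=
  constructive_indefinite_description _ (vt1_inverse M).

Lemma vt0_inv_nat (A B : D) (f : Hom A B) :
  fmap F f ∘ sval (b0 A) = sval (b0 B) ∘ fmap G f.
Proof.
have [_ ab] := svalP (b0 A); have [ba _] := svalP (b0 B).
exact: square_inverse (nt_nat a f) ab ba.
Qed.

Definition vt_inv : VTrans G F.
Proof.
refine (@Build_VTrans D E G F (Build_NatTrans vt0_inv_nat)
  (fun A B M => sval (b1 M)) _).
move=> A B A' B' M M' u v f.
have [_ ab] := svalP (b1 M); have [ba _] := svalP (b1 M').
exact: (@square_inverse (cell_cat E) _ _ _ _ (packed (vt1 a M))
    (packed (vt1 a M')) (packed (dcell G f)) (packed (dcell F f))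
    (packed (sval (b1 M))) (packed (sval (b1 M'))) (vt1_nat a f) ab ba).
Defined.

Lemma vt0_invK (A : D) : vt_inv A ∘ a A = idm (F A).
Proof. by case: (svalP (b0 A)). Qed.

Lemma vt0_invKr (A : D) : a A ∘ vt_inv A = idm (G A).
Proof. by case: (svalP (b0 A)). Qed.

Lemma vt1_invK (A B : D) (M : Hor A B) :
  ccomp (vt1 vt_inv M) (vt1 a M) ≡ cid (dhor F M).
Proof. by case: (svalP (b1 M)). Qed.

Lemma vt1_invKr (A B : D) (M : Hor A B) :
  ccomp (vt1 a M) (vt1 vt_inv M) ≡ cid (dhor G M).
Proof. by case: (svalP (b1 M)). Qed.

Lemma vt_inv_iso : vt_iso vt_inv.
Proof.
split=> [A|A B M].
  by exists (a A); split; [apply: vt0_invKr|apply: vt0_invK].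
by exists (a A), (a B), (vt1 a M); split; [apply: vt1_invKr|apply: vt1_invK].
Qed.

Lemma hidc_vt_invKr (A : D) :
  ccomp (hidc (a A)) (hidc (vt_inv A)) ≡ cid (hid (G A)).
Proof. by rewrite -hidcD vt0_invKr hidc1. Qed.

Lemma hcompc_vt_invKr (A B C : D) (M : Hor A B) (N : Hor B C) :
  ccomp (hcompc (vt1 a M) (vt1 a N)) (hcompc (vt1 vt_inv M) (vt1 vt_inv N))
    ≡ cid (hcomp (dhor G M) (dhor G N)).
Proof. by apply: hcompc_inverse; apply: vt1_invKr. Qed.
End InverseTransformation.

Lemma dcell_inverse (X Y : PseudoDoubleCategory) (H : DoubleMap X Y)
    (A B : X) (M N : Hor A B) (f : Cell M N (idm A) (idm B))
    (g : Cell N M (idm A) (idm B)) :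
  ccomp g f ≡ cid M -> ccomp (dcell H g) (dcell H f) ≡ cid (dhor H M).
Proof.
move=> gf; rewrite -(dcell1 H M) -(pack_dcell H gf); exact: esym (dcellD _ _ _).
Qed.

(* The mate conditions say that the comparison cells of [F] and [G] correspond
   to each other under the adjunction, so that inverting those of one of the
   two makes [eta] and [eps] compatible with both structures. *)
Section Conjoint.
Context (D E : PseudoDoubleCategory) (F : OplaxDoubleFunctor D E)
  (G : LaxDoubleFunctor E D)
  (eta : VTrans (dm_id D) (dm_comp G F)) (eps : VTrans (dm_comp F G) (dm_id E)).

Record mates : Prop := {
  mate_eta_unit : forall A : D,
    ccomp (lax_unit (lstr G) (F A)) (hidc (eta A))
      ≡ ccomp (dcell G (oplax_unit (ostr F) A)) (vt1 eta (hid A));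
  mate_eta_comp : forall (A B C : D) (M : Hor A B) (N : Hor B C),
    ccomp (lax_comp (lstr G) (dhor F M) (dhor F N))
        (hcompc (vt1 eta M) (vt1 eta N))
      ≡ ccomp (dcell G (oplax_comp (ostr F) M N)) (vt1 eta (hcomp M N));
  mate_eps_unit : forall A : E,
    ccomp (hidc (eps A)) (oplax_unit (ostr F) (G A))
      ≡ ccomp (vt1 eps (hid A)) (dcell F (lax_unit (lstr G) A));
  mate_eps_comp : forall (A B C : E) (M : Hor A B) (N : Hor B C),
    ccomp (hcompc (vt1 eps M) (vt1 eps N))
        (oplax_comp (ostr F) (dhor G M) (dhor G N))
      ≡ ccomp (vt1 eps (hcomp M N)) (dcell F (lax_comp (lstr G) M N))
}.

Context (mt : mates) (FP : oplax_is_pseudo F) (GP : lax_is_pseudo G)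
  (etaI : vt_iso eta) (epsI : vt_iso eps).

(** The inverse of [F] is [G] with its comparison cells inverted, and [eta] and [eps] are kept.
    Compatibility follows by moving the comparison cells of [G] across the mate conditions. *)
Lemma conjoint_oplax_equivalence : oplax_double_equivalence F.
Proof.
split=> //; exists (oplax_of_pseudo GP); split; first exact: oplax_of_pseudoP.
exists eta, eps; split=> //; split.
(* The comparison cells of the identity are identities, and those of a composite differ from a plain
   composite of cells by a cast; both disappear in the total space. *)
- move=> A; apply: etrans (ccomp1 _) _.
  apply: etrans _ (esym (pack_ccomp (pack_ccast _ _ _) erefl)).
  apply: etrans _ (esym (ccompA _ _ _)).
  apply: (@cancel_left (cell_cat D) _ _ _ (packed (lax_unit (lstr G) (F A)))
    (packed (globular_inv (GP.1 (F A)))) (packed (hidc (eta A)))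
    (packed (ccomp (dcell G (oplax_unit (ostr F) A)) (vt1 eta (hid A))))).
    exact: globular_invK.
  exact: mate_eta_unit.
- move=> A B C M N; apply: etrans (ccomp1 _) _.
  apply: etrans _ (esym (pack_ccomp (pack_ccast _ _ _) erefl)).
  apply: etrans _ (esym (ccompA _ _ _)).
  apply: (@cancel_left (cell_cat D) _ _ _
    (packed (lax_comp (lstr G) (dhor F M) (dhor F N)))
    (packed (globular_inv (GP.2 _ _ _ (dhor F M) (dhor F N))))
    (packed (hcompc (vt1 eta M) (vt1 eta N)))
    (packed (ccomp (dcell G (oplax_comp (ostr F) M N))
      (vt1 eta (hcomp M N))))).
    exact: globular_invK.
  exact: mate_eta_comp.
- move=> A; apply: etrans _ (esym (ccomp1l _)).
  apply: etrans (pack_ccomp erefl (pack_ccast _ _ _)) _.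
  apply: etrans (esym (ccompA _ _ _)) _; apply: esym.
  apply: (@cancel_right (cell_cat E) _ _ _
    (packed (dcell F (lax_unit (lstr G) A)))
    (packed (dcell F (globular_inv (GP.1 A)))) (packed (vt1 eps (hid A)))
    (packed (ccomp (hidc (eps A)) (oplax_unit (ostr F) (G A))))).
    by apply: dcell_inverse; apply: globular_invKr.
  exact: esym (mate_eps_unit mt A).
- move=> A B C M N; apply: etrans _ (esym (ccomp1l _)).
  apply: etrans (pack_ccomp erefl (pack_ccast _ _ _)) _.
  apply: etrans (esym (ccompA _ _ _)) _; apply: esym.
  apply: (@cancel_right (cell_cat E) _ _ _
    (packed (dcell F (lax_comp (lstr G) M N)))
    (packed (dcell F (globular_inv (GP.2 _ _ _ M N))))
    (packed (vt1 eps (hcomp M N)))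
    (packed (ccomp (hcompc (vt1 eps M) (vt1 eps N))
        (oplax_comp (ostr F) (dhor G M) (dhor G N))))).
    by apply: dcell_inverse; apply: globular_invKr.
  exact: esym (mate_eps_comp mt M N).
Qed.

(** Now [F] with inverted comparison cells is the inverse of [G], so the roles are exchanged: the
    inverse of [eps] is the unit and the inverse of [eta] the counit. *)
Lemma conjoint_lax_equivalence : lax_double_equivalence G.
Proof.
split=> //; exists (lax_of_pseudo FP); split; first exact: lax_of_pseudoP.
exists (vt_inv epsI), (vt_inv etaI).
split; [split|split|exact: vt_inv_iso|exact: vt_inv_iso].
- move=> A; apply: etrans _ (esym (ccomp1 _)).
  apply: etrans (pack_ccomp (pack_ccast _ _ _) erefl) _.
  apply: (@mate_inverse_right (cell_cat E) _ _ _ _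
    (packed (oplax_unit (ostr F) (G A))) (packed (hidc (eps A)))
    (packed (dcell F (lax_unit (lstr G) A))) (packed (vt1 eps (hid A)))
    (packed (globular_inv (FP.1 (G A)))) (packed (hidc (vt_inv epsI A)))
    (packed (vt1 (vt_inv epsI) (hid A)))).
  + exact: mate_eps_unit.
  + exact: globular_invKr.
  + exact: (hidc_vt_invKr epsI A).
  + exact: (vt1_invK epsI _).
- move=> A B C M N; apply: etrans _ (esym (ccomp1 _)).
  apply: etrans (pack_ccomp (pack_ccast _ _ _) erefl) _.
  apply: (@mate_inverse_right (cell_cat E) _ _ _ _
    (packed (oplax_comp (ostr F) (dhor G M) (dhor G N)))
    (packed (hcompc (vt1 eps M) (vt1 eps N)))
    (packed (dcell F (lax_comp (lstr G) M N))) (packed (vt1 eps (hcomp M N)))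
    (packed (globular_inv (FP.2 _ _ _ (dhor G M) (dhor G N))))
    (packed (hcompc (vt1 (vt_inv epsI) M) (vt1 (vt_inv epsI) N)))
    (packed (vt1 (vt_inv epsI) (hcomp M N)))).
  + exact: mate_eps_comp.
  + exact: globular_invKr.
  + exact: (hcompc_vt_invKr epsI M N).
  + exact: (vt1_invK epsI _).
- move=> A; apply: etrans (ccomp1l _) _.
  apply: etrans _ (esym (pack_ccomp erefl (pack_ccast _ _ _))).
  apply: (@mate_inverse_left (cell_cat D) _ _ _ _ (packed (hidc (eta A)))
    (packed (lax_unit (lstr G) (F A))) (packed (vt1 eta (hid A)))
    (packed (dcell G (oplax_unit (ostr F) A))) (packed (hidc (vt_inv etaI A)))
    (packed (vt1 (vt_inv etaI) (hid A)))
    (packed (dcell G (globular_inv (FP.1 A))))).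
  + exact: mate_eta_unit.
  + exact: (hidc_vt_invKr etaI A).
  + exact: (vt1_invK etaI _).
  + exact: (dcell_inverse G (globular_invK (FP.1 A))).
- move=> A B C M N; apply: etrans (ccomp1l _) _.
  apply: etrans _ (esym (pack_ccomp erefl (pack_ccast _ _ _))).
  apply: (@mate_inverse_left (cell_cat D) _ _ _ _
    (packed (hcompc (vt1 eta M) (vt1 eta N)))
    (packed (lax_comp (lstr G) (dhor F M) (dhor F N)))
    (packed (vt1 eta (hcomp M N)))
    (packed (dcell G (oplax_comp (ostr F) M N)))
    (packed (hcompc (vt1 (vt_inv etaI) M) (vt1 (vt_inv etaI) N)))
    (packed (vt1 (vt_inv etaI) (hcomp M N)))
    (packed (dcell G (globular_inv (FP.2 _ _ _ M N))))).
  + exact: mate_eta_comp.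
  + exact: (hcompc_vt_invKr etaI M N).
  + exact: (vt1_invK etaI _).
  + exact: (dcell_inverse G (globular_invK (FP.2 _ _ _ M N))).
Qed.
End Conjoint.

(** * From double equivalences to equivalences of categories of 2-cells *)

Section CellFunctor.
Context (D E : PseudoDoubleCategory).

Definition cell_functor (F : DoubleMap D E) :
  Functor (cell_cat D) (cell_cat E).
Proof.
refine (@Build_Functor (cell_cat D) (cell_cat E)
  (fun M => harrow (dhor F (hor_arr M)))
  (fun _ _ f => packed (dcell F (projT2 (projT2 f)))) _ _).
- by move=> M; apply: dcell1.
- by move=> M N P [u [v g]] [u' [v' f]]; apply: dcellD.
Defined.

Lemma cell_functor_iso (F G : DoubleMap D E) (a : VTrans F G) (aI : vt_iso a)
    (A B : D) (M : Hor A B) : is_iso (packed (vt1 a M)).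
Proof. by apply/cell_iso_packed; apply: aI.2. Qed.
End CellFunctor.

Lemma cell_functor_equivalence (D E : PseudoDoubleCategory)
    (F : DoubleMap D E) (G : DoubleMap E D)
    (eta : VTrans (dm_id D) (dm_comp G F))
    (eps : VTrans (dm_comp F G) (dm_id E)) :
  vt_iso eta -> vt_iso eps -> is_equivalence (cell_functor F).
Proof.
move=> etaI epsI; exists (cell_functor G).
unshelve eexists; [|unshelve eexists].
- refine (@Build_NatTrans _ _ (functor_id (cell_cat D))
    (functor_comp (cell_functor G) (cell_functor F))
    (fun M => packed (vt1 eta (hor_arr M))) _).
  by move=> M N [u [v f]]; apply: (vt1_nat eta f).
- refine (@Build_NatTrans _ _ (functor_comp (cell_functor F) (cell_functor G))
    (functor_id (cell_cat E)) (fun M => packed (vt1 eps (hor_arr M))) _).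
  by move=> M N [u [v f]]; apply: (vt1_nat eps f).
- split=> M; first exact: (cell_functor_iso etaI (hor_arr M)).
  exact: (cell_functor_iso epsI (hor_arr M)).
Qed.

(** * Fibres over copowers of the terminal object *)

Section Fibres.
Context (V : Category) (L : FiniteLimits V) (S : SmallCoproducts V).
Local Notation pt := (copower1 L S).

Definition index_map (I : SmallSet) (X : I -> V) : Hom (coprod S X) (pt I) :=
  copair (fun i => inj i ∘ bang (X i)).

Lemma index_map_inj (I : SmallSet) (X : I -> V) (i : I) :
  index_map X ∘ inj i = inj i ∘ bang (X i).
Proof. exact: copair_inj. Qed.

Lemma const_comp (I : SmallSet) (A X Y : V) (p : Hom A (pt I)) (h : Hom X A)
    (k : Hom Y X) (i : I) :
  p ∘ h = inj i ∘ bang X -> p ∘ (h ∘ k) = inj i ∘ bang Y.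
Proof.
by move=> ph; rewrite -compmA ph compmA; congr (_ ∘ _); apply: one_ext.
Qed.

(** The universal property of the pullback of [p] along the coprojection at [i]. The projection to
    the terminal object is left implicit, so a cone is just a map [h] made constant by [p]. *)
Definition is_fibre (I : SmallSet) (A : V) (p : Hom A (pt I)) (i : I)
    (Y : V) (y : Hom Y A) : Prop :=
  p ∘ y = inj i ∘ bang Y /\
  forall (X : V) (h : Hom X A), p ∘ h = inj i ∘ bang X ->
    exists! k : Hom X Y, y ∘ k = h.

Definition is_coproduct (I : SmallSet) (Y : I -> V) (A : V)
    (y : forall i, Hom (Y i) A) : Prop :=
  forall (Z : V) (f : forall i, Hom (Y i) Z),
    exists! g : Hom A Z, forall i, g ∘ y i = f i.

Definition coproduct_fibres : Prop :=
  forall (I : SmallSet) (X : I -> V) (i : I),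
    is_fibre (index_map X) i (@inj V S I X i).

Definition fibres_cover : Prop :=
  forall (I : SmallSet) (A : V) (p : Hom A (pt I)) (Y : I -> V)
    (y : forall i, Hom (Y i) A),
    (forall i, is_fibre p i (y i)) -> is_coproduct y.

Section FibreTheory.
Context (I : SmallSet) (A : V) (p : Hom A (pt I)) (i : I).

Lemma fibre_monic (Y : V) (y : Hom Y A) (X : V) (h k : Hom X Y) :
  is_fibre p i y -> y ∘ h = y ∘ k -> h = k.
Proof.
move=> [py yU] hk; case: (yU X (y ∘ k) (const_comp _ py)) => l [_ lU].
by rewrite -(lU h hk) (lU k).
Qed.

Lemma fibre_pullback :
  is_fibre p i (@pb1 V L _ _ _ p (@inj V S I (fun _ => one L) i)).
Proof.
split=> [|X h ph]; first by rewrite pb_comm; congr (_ ∘ _); apply: one_ext.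
exists (pbpair ph); split=> [|k kE]; first exact: pb1_pbpair.
by apply: pb_ext; [rewrite pb1_pbpair kE|apply: one_ext].
Qed.

Lemma fibre_iso (Y Y' : V) (y : Hom Y A) (y' : Hom Y' A) (k : Hom Y Y') :
  is_fibre p i y -> is_fibre p i y' -> y' ∘ k = y -> is_iso k.
Proof.
move=> yF y'F kE; case: (y'F) => py' _; case: (yF) => _ yU.
have [l [lE _]] := yU Y' y' py'.
exists l; split.
  by apply: (fibre_monic yF); rewrite -compmA lE kE compm1.
by apply: (fibre_monic y'F); rewrite -compmA kE lE compm1.
Qed.

End FibreTheory.

Lemma coproduct_copair_iso (I : SmallSet) (Y : I -> V) (A : V)
    (y : forall i, Hom (Y i) A) :
  is_coproduct y <-> is_iso (@copair V S I Y A y).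
Proof.
split=> [yU|[r [ry yr]] Z f].
  have [r [rE _]] := yU _ (fun i => @inj V S I Y i).
  exists r; split; first by apply: coprod_ext => i; cat_norm.
  have [g [_ gU]] := yU _ y.
  rewrite -(gU (idm A)) => [|i]; last exact: comp1m.
  by apply: esym; apply: gU => i; rewrite compmA rE copair_inj.
exists (copair f ∘ r); split=> [i|g gE].
  by rewrite -(copair_inj (S := S) y i) compmA -(compmA r) ry comp1m copair_inj.
have -> : copair f = g ∘ @copair V S I Y A y.
  by apply: coprod_ext => i; rewrite compmA !copair_inj gE.
by rewrite compmA yr compm1.
Qed.

(** Fibres over the same point are isomorphic over [A], so being a coproduct does not depend on how
    they are chosen. This moves freely between chosen pullbacks and arbitrary fibres. *)
Lemma fibres_coproduct (I : SmallSet) (A : V) (p : Hom A (pt I))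
    (Y Y' : I -> V) (y : forall i, Hom (Y i) A) (y' : forall i, Hom (Y' i) A) :
  (forall i, is_fibre p i (y i)) -> (forall i, is_fibre p i (y' i)) ->
  is_coproduct y -> is_coproduct y'.
Proof.
move=> yF y'F yU Z f.
have exk i : exists k : Hom (Y i) (Y' i), y' i ∘ k = y i.
  by have [k [kE _]] := (y'F i).2 _ (y i) (yF i).1; exists k.
have [k kE] := dependent_choice_fun exk.
have kI i : is_iso (k i) by apply: fibre_iso (yF i) (y'F i) (kE i).
have [g [gE gU]] := yU Z (fun i => f i ∘ k i).
exists g; split=> [i|h hE].
  by apply: (iso_epic (kI i)); rewrite compmA kE gE.
by apply: gU => i; rewrite -kE -compmA hE.
Qed.

(** The unit at [X] compares [X i] with the chosen fibre of [index_map X], and the counit at [p] is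
    the copairing of the chosen fibres of [p]. *)
Lemma adjoint_equivalence_fibres :
  (forall I : SmallSet, is_adjoint_equivalence (coprod_adjunction L S I)) ->
  coproduct_fibres /\ fibres_cover.
Proof.
move=> adjI; split=> [I X i|I A p Y y yF].
  have [etaI _] := adjI I.
  have := iffLR (prod_iso _) (etaI X) i => /= kI.
  pose k : Hom (X i) (pullback L (index_map X) (inj i)) :=
    pbpair (adj_unitP L S X i).
  have kE : pb1 ∘ k = inj i := pb1_pbpair L _.
  have [l [lk kl]] : is_iso k := kI.
  have [_ pF] := fibre_pullback (index_map X) i.
  split=> [|Z h hE]; first exact: index_map_inj.
  have [m [mE mU]] := pF Z h hE.
  exists (l ∘ m); split=> [|n nE].
    by rewrite -kE compmA -(compmA k) kl comp1m.
  by rewrite (mU (k ∘ n)) -?compmA ?lk ?comp1m // kE.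
have [_ epsI] := adjI I.
have := iffLR (slice_iso _) (epsI (Build_slice_ob p)) => /= pI.
apply: (fibres_coproduct (fun i => fibre_pullback p i) yF).
exact/coproduct_copair_iso.
Qed.

(** * Extensivity from fibres *)

Section Extensive.
Context (U : coproduct_fibres) (C : fibres_cover) (I : SmallSet) (X : I -> V).

(** The pullback of [f] along a coprojection is pasted to the pullback square that [U] provides for
    that coprojection. *)
Lemma pullback_inj_fibre (A : V) (f : Hom A (coprod S X)) (i : I) :
  is_fibre (index_map X ∘ f) i (@pb1 V L _ _ _ f (@inj V S I X i)).
Proof.
split=> [|Z h]; first by rewrite compmA pb_comm; apply: const_comp (U X i).1.
rewrite compmA => fh; have [k [kE _]] := (U X i).2 Z _ fh.
exists (pbpair (esym kE)); split=> [|l lE]; first exact: pb1_pbpair.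
apply: pb_ext; first by rewrite pb1_pbpair lE.
by apply: (fibre_monic (U X i)); rewrite pb2_pbpair kE -lE -!compmA pb_comm.
Qed.

Lemma slice_pullback_mapP (f g : slice (coprod S X)) (h : Hom f g) (i : I) :
  slice_map g ∘ (sval h ∘ pb1)
  = @inj V S I X i ∘ @pb2 V L _ _ _ (slice_map f) (inj i).
Proof. by rewrite -compmA (svalP h) pb_comm. Qed.

Definition slice_pullback :
  Functor (slice (coprod S X)) (prod_cat (fun i => slice (X i))).
Proof.
refine (@Build_Functor (slice (coprod S X)) (prod_cat (fun i => slice (X i)))
  (fun f i => @Build_slice_ob V (X i) (pullback L (slice_map f) (inj i)) pb2)
  (fun f g h i => exist _ (pbpair (slice_pullback_mapP h i)) (pb2_pbpair L _))
  _ _).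
- move=> f; apply: functional_extensionality_dep => i.
  by apply: slice_hom_eq; apply: pb_ext; cat_norm.
- move=> f g k h' h; apply: functional_extensionality_dep => i.
  by apply: slice_hom_eq; apply: pb_ext; cat_norm.
Defined.

Lemma slice_coprod_unitP (f : prod_cat (fun i => slice (X i))) (i : I) :
  slice_map (slice_coprod S X f) ∘ inj i = inj i ∘ slice_map (f i).
Proof. by cat_norm. Qed.

Definition slice_coprod_unit :
  NatTrans (functor_id (prod_cat (fun i => slice (X i))))
    (functor_comp slice_pullback (slice_coprod S X)).
Proof.
refine (@Build_NatTrans _ _ (functor_id (prod_cat (fun i => slice (X i))))
  (functor_comp slice_pullback (slice_coprod S X))
  (fun f i => exist _ (pbpair (slice_coprod_unitP f i)) (pb2_pbpair L _)) _).
move=> f g h; apply: functional_extensionality_dep => i.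
apply: slice_hom_eq; apply: pb_ext; cat_norm => //.
exact: esym (svalP (h i)).
Defined.

Lemma slice_coprod_counitP (f : slice (coprod S X)) :
  slice_map f ∘ copair (fun i => pb1)
  = slice_map (slice_coprod S X (slice_pullback f)).
Proof. by apply: coprod_ext => i; cat_norm; rewrite pb_comm. Qed.

Definition slice_coprod_counit :
  NatTrans (functor_comp (slice_coprod S X) slice_pullback)
    (functor_id (slice (coprod S X))).
Proof.
refine (@Build_NatTrans _ _ (functor_comp (slice_coprod S X) slice_pullback)
  (functor_id (slice (coprod S X)))
  (fun f => exist _ _ (slice_coprod_counitP f)) _).
by move=> f g h; apply: slice_hom_eq; apply: coprod_ext => i; cat_norm.
Defined.

Lemma fibres_slice_coprod : is_equivalence (slice_coprod S X).
Proof.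
exists slice_pullback, slice_coprod_unit, slice_coprod_counit; split=> f.
  apply/prod_iso => i; apply/slice_iso => /=.
  have F := U (fun i => slice_dom (f i)) i.
  (* The index map of the coproduct of the domains factors through [coprod S X]. Hence the
     coprojection and the pullback along [inj i] are fibres of the same map, and the unit compares
     them. *)
  have pE : index_map (fun i => slice_dom (f i))
      = index_map X ∘ slice_map (slice_coprod S X f).
    apply: coprod_ext => j; rewrite index_map_inj /= compmA copair_inj.
    by rewrite (const_comp _ (U X j).1).
  rewrite pE in F.
  exact: fibre_iso F (pullback_inj_fibre _ i) (pb1_pbpair L _).
apply/slice_iso => /=; apply/coproduct_copair_iso.
exact: C (fun i => pullback_inj_fibre (slice_map f) i).
Qed.

End Extensive.

Lemma fibres_extensive : coproduct_fibres -> fibres_cover -> extensive S.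
Proof. by move=> U C I X; apply: fibres_slice_coprod. Qed.

(** Extensivity for the constant family at the terminal object, transferred along the identification
    of [V] with its slice over that object, makes the left adjoint fully faithful and essentially
    surjective. *)
Lemma extensive_adjoint_equivalence (I : SmallSet) :
  extensive S -> is_adjoint_equivalence (coprod_adjunction L S I).
Proof.
move=> ext.
have eqv := ext I (fun _ => one L).
apply: left_adjoint_equivalence.
- move=> A B h.
  have [f [fE fU]] := equivalence_fully_faithful eqv
    (A := fun i => to_slice1 L (A i)) (B := fun i => to_slice1 L (B i)) h.
  exists (fun i => sval (f i)); split=> [|g gE].
    by rewrite -fE; apply: slice_hom_eq.
  apply: functional_extensionality_dep => i.
  by rewrite (fU (fun i => fmap (to_slice1 L) (g i)) gE).
- move=> B; have [A [f fI]] := equivalence_essentially_surjective eqv B.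
  have AE : A = fun i => to_slice1 L (slice_dom (A i)).
    apply: functional_extensionality_dep => i; case: (A i) => D m.
    by rewrite /to_slice1 /= (one_ext m (bang D)).
  exists (fun i => slice_dom (A i)).
  by move: f fI; rewrite {1 2}AE => f fI; exists f.
Qed.
End Fibres.

(** * Int and En fibrewise *)

Section IntEnFibres.
Context (V : Category) (L : FiniteLimits V) (E : CartesianClosed L)
  (S : SmallCoproducts V).
Local Notation pt := (copower1 L S).
Local Notation cst i X := (@inj _ S _ (fun _ => one L) i ∘ @bang _ L X).

Local Notation en_pr a i j :=
  (@pb1 V L _ _ _ (pairm (legl a) (legr a))
     (@pairm V L (pt _) (pt _) (one L) (inj i) (inj j))).

(** The comparison obtained by distributing the product over each copower in turn, which is where
    cartesian closedness enters. *)
Definition pt_pair (I J : SmallSet) :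
    Hom (prodm L (pt I) (pt J)) (pt (I * J)%type) :=
  dcopair_l E (fun i => dcopair_r E (fun j =>
    @inj V S (I * J)%type (fun _ => one L) (i, j) ∘ pr1)).

Lemma pt_pair_inj (I J : SmallSet) (i : I) (j : J) (X : V)
    (a b : Hom X (one L)) :
  pt_pair I J ∘ pairm (inj i ∘ a) (inj j ∘ b) = cst (i, j) X.
Proof.
rewrite /pt_pair dcopair_l_inj dcopair_r_inj compmA pr1_pairm.
by congr (_ ∘ _); apply: one_ext.
Qed.

Lemma pt_pair_fst (I J : SmallSet) :
  copower1_map L S fst ∘ pt_pair I J = pr1.
Proof.
apply: (jepi_l E (@jepi_inj V S _ _)) => i.
apply: (jepi_r E (@jepi_inj V S _ _)) => j.
cat_norm; rewrite pt_pair_inj /copower1_map -compmA copair_inj.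
by congr (_ ∘ _); apply: one_ext.
Qed.

Lemma pt_pair_snd (I J : SmallSet) :
  copower1_map L S snd ∘ pt_pair I J = pr2.
Proof.
apply: (jepi_l E (@jepi_inj V S _ _)) => i.
apply: (jepi_r E (@jepi_inj V S _ _)) => j.
cat_norm; rewrite pt_pair_inj /copower1_map -compmA copair_inj.
by congr (_ ∘ _); apply: one_ext.
Qed.

(** Both coordinates are recovered from the pair of indices by the copower maps of [fst] and [snd],
    so nothing is lost by passing to a single index. *)
Lemma pt_pair_const (I J : SmallSet) (X : V) (x : Hom X (pt I))
    (y : Hom X (pt J)) (i : I) (j : J) :
  pt_pair I J ∘ pairm x y = cst (i, j) X <-> x = cst i X /\ y = cst j X.
Proof.
split=> [xy|[-> ->]]; last exact: pt_pair_inj.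
split.
  rewrite -(pr1_pairm L x y) -pt_pair_fst compmA xy -compmA.
  by rewrite /copower1_map copair_inj.
rewrite -(pr2_pairm L x y) -pt_pair_snd compmA xy -compmA.
by rewrite /copower1_map copair_inj.
Qed.

Definition span_index (I J : SmallSet) (a : span L S I J) :
    Hom (apex a) (pt (I * J)%type) :=
  pt_pair I J ∘ pairm (legl a) (legr a).

Lemma span_index_const (I J : SmallSet) (a : span L S I J) (X : V)
    (h : Hom X (apex a)) (i : I) (j : J) :
  span_index a ∘ h = cst (i, j) X <->
  legl a ∘ h = cst i X /\ legr a ∘ h = cst j X.
Proof. by rewrite /span_index compmA pairm_comp; apply: pt_pair_const. Qed.

Lemma en_fibre (I J : SmallSet) (a : span L S I J) (i : I) (j : J) :
  is_fibre (span_index a) (i, j) (en_pr a i j).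
Proof.
split=> [|X h /(iffLR (span_index_const h i j)) [hl hr]].
  by apply/span_index_const; rewrite en_mat_legl en_mat_legr.
exists (pbpair (en_matP hl hr)); split=> [|k kE]; first exact: pb1_pbpair.
by apply: en_ext; rewrite pb1_pbpair kE.
Qed.

Lemma int_legl (I J : SmallSet) (M : mat V I J) (i : I) (j : J) :
  legl (int_span L S M) ∘ int_inj S M i j = cst i (M i j).
Proof. exact: int_copair_inj. Qed.

Lemma int_legr (I J : SmallSet) (M : mat V I J) (i : I) (j : J) :
  legr (int_span L S M) ∘ int_inj S M i j = cst j (M i j).
Proof. exact: int_copair_inj. Qed.

Lemma int_index (I J : SmallSet) (M : mat V I J) :
  span_index (int_span L S M) = index_map L S (fun p => M p.1 p.2).
Proof.
apply: coprod_ext => -[i j]; rewrite index_map_inj.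
apply: (iffRL (span_index_const (a := int_span L S M) (int_inj S M i j) i j)).
by split; [apply: int_legl|apply: int_legr].
Qed.

(** Unit of the adjunction between Int and En: each coprojection lands in its own fibre. *)
Definition eta_cell (I J : SmallSet) (M : mat V I J) :
    mat_cell M (en_mat (int_span L S M)) (fun i => i) (fun j => j) :=
  fun i j => pbpair (en_matP (int_legl M i j) (int_legr M i j)).

Lemma eps_cellP1 (I J : SmallSet) (a : span L S I J) :
  legl a ∘ int_copair S (M := en_mat a) (fun i j => en_pr a i j)
  = copower1_map L S (fun i => i) ∘ legl (int_span L S (en_mat a)).
Proof.
apply: leg_id; apply: int_ext => i j.
by rewrite /= compmA !int_copair_inj en_mat_legl.
Qed.

Lemma eps_cellP2 (I J : SmallSet) (a : span L S I J) :
  legr a ∘ int_copair S (M := en_mat a) (fun i j => en_pr a i j)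
  = copower1_map L S (fun j => j) ∘ legr (int_span L S (en_mat a)).
Proof.
apply: leg_id; apply: int_ext => i j.
by rewrite /= compmA !int_copair_inj en_mat_legr.
Qed.

(** Counit of the same adjunction: the coproduct of the fibres of the apex maps back to the apex. *)
Definition eps_cell (I J : SmallSet) (a : span L S I J) :
    span_cell (int_span L S (en_mat a)) a (fun i => i) (fun j => j) :=
  @Build_span_cell V L S I J I J (int_span L S (en_mat a)) a (fun i => i)
    (fun j => j) _ (eps_cellP1 a) (eps_cellP2 a).

(** * Invertibility of the unit, the counit and the comparison cells *)

Section Covering.
Context (U : coproduct_fibres L S) (C : fibres_cover L S).

Lemma int_fibre (I J : SmallSet) (M : mat V I J) (i : I) (j : J) :
  is_fibre (span_index (int_span L S M)) (i, j) (int_inj S M i j).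
Proof. by rewrite int_index; apply: (U (fun p => M p.1 p.2) (i, j)). Qed.

Lemma eta_cell_iso (I J : SmallSet) (M : mat V I J) (i : I) (j : J) :
  is_iso (eta_cell M i j).
Proof.
exact: fibre_iso (int_fibre M i j) (en_fibre _ i j) (pb1_pbpair L _).
Qed.

Lemma eps_cell_iso (I J : SmallSet) (a : span L S I J) :
  is_iso (span_map (eps_cell a)).
Proof.
apply/coproduct_copair_iso; apply: (C (p := span_index a)) => -[i j].
exact: en_fibre.
Qed.

(** Off the diagonal the entries of [mat_id] are empty coproducts, so only one copy of the terminal
    object for each [i] remains. *)
Lemma int_unit_iso (I : SmallSet) : is_iso (span_map (int_unit L S I)).
Proof.
pose M := @mat_id V L S I.
exists (copair (fun i => int_inj S M i i ∘ @inj V S (i = i) _ erefl)); split.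
  apply: int_ext => i j; apply: coprod_ext => e; case: j / e => /=.
  by rewrite compmA int_copair_inj compmA copair_inj copair_inj comp1m.
apply: coprod_ext => i /=.
by rewrite compmA copair_inj -compmA int_copair_inj copair_inj comp1m.
Qed.

Section IntComp.
Context (I J K : SmallSet) (M : mat V I J) (N : mat V J K).
Local Notation P :=
  (pullback L (legr (int_span L S M)) (legl (int_span L S N))).

(** The middle index is read off from the first span only; on the pullback it agrees with the one
    given by the second. *)
Definition int_comp_index : Hom P (pt (I * J * K)%type) :=
  pt_pair (I * J)%type K
    ∘ pairm (span_index (int_span L S M) ∘ pb1) (legr (int_span L S N) ∘ pb2).

Definition int_comp_leg (p : I * J * K) :
    Hom (prodm L (N p.1.2 p.2) (M p.1.1 p.1.2)) P :=
  pbpair (int_compP L S M N p.1.1 p.1.2 p.2).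

(** A map into the pullback lying over [(i, j, k)] has its components in the fibres [M i j] and
    [N j k], so it is a map into their product. *)
Lemma int_comp_fibre (i : I) (j : J) (k : K) :
  is_fibre int_comp_index (i, j, k) (int_comp_leg (i, j, k)).
Proof.
rewrite /int_comp_leg /=; split=> [|X h].
  rewrite /int_comp_index compmA pairm_comp; apply/pt_pair_const; split.
    by rewrite compmA pb1_pbpair; apply: const_comp (int_fibre M i j).1.
  by rewrite compmA pb2_pbpair; apply: const_comp (int_legr N j k).
rewrite /int_comp_index compmA pairm_comp (compmA (span_index _))
  (compmA (legr _)); case/(iffLR (pt_pair_const _ _ _ _)) => hM hr.
have [_ hm] := iffLR (span_index_const (a := int_span L S M) _ _ _) hM.
(* The pullback square passes the index [j] from the right leg of the first span to the left leg of
   the second. *)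
have hN : span_index (int_span L S N) ∘ (pb2 ∘ h) = cst (j, k) X.
  by apply/span_index_const; split=> //; rewrite -pb_commA.
have [m [mE _]] := (int_fibre M i j).2 X _ hM.
have [n [nE _]] := (int_fibre N j k).2 X _ hN.
exists (pairm n m); split=> [|l lE].
  apply: pb_ext; rewrite -compmA ?pb1_pbpair ?pb2_pbpair compmA.
    by rewrite pr2_pairm.
  by rewrite pr1_pairm.
apply: prod_ext; rewrite ?pr1_pairm ?pr2_pairm.
  apply: (fibre_monic (int_fibre N j k)).
  by rewrite nE -lE -(compmA pb2) pb2_pbpair compmA.
apply: (fibre_monic (int_fibre M i j)).
by rewrite mE -lE -(compmA pb1) pb1_pbpair compmA.
Qed.

(** By [C] the pullback is a coproduct over triples. The apex of the image of the matrix product has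
    the same summands, grouped first by [(i, k)] and then by [j], and [g] regroups them. *)
Lemma int_comp_iso : is_iso (span_map (int_comp L S M N)).
Proof.
have cov : is_coproduct int_comp_leg.
  by apply: (@C _ P int_comp_index _ int_comp_leg) => -[[i j] k];
    apply: int_comp_fibre.
have [g [gE _]] := cov _ (fun p : I * J * K =>
  int_inj S (mat_comp L S M N) p.1.1 p.2
    ∘ @inj V S J (fun j => prodm L (N j p.2) (M p.1.1 j)) p.1.2).
have intE i j k : span_map (int_comp L S M N)
    ∘ (int_inj S (mat_comp L S M N) i k
       ∘ @inj V S J (fun j => prodm L (N j k) (M i j)) j)
    = int_comp_leg (i, j, k).
  by rewrite /= -compmA int_copair_inj copair_inj.
exists g; split.
  apply: int_ext => i k; apply: coprod_ext => j.
  by rewrite !compmA intE comp1m (gE (i, j, k)).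
have [f [_ fU]] := cov _ int_comp_leg.
rewrite -(fU (idm P)) => [|[[i j] k]]; last exact: comp1m.
by apply: esym; apply: fU => -[[i j] k]; rewrite compmA gE intE.
Qed.
End IntComp.

Section EnComp.
Context (I J K : SmallSet) (a : span L S I J) (b : span L S J K)
  (i : I) (k : K).

Definition en_comp_index : Hom (en_mat (span_comp a b) i k) (pt J) :=
  legr a ∘ (@pb1 V L _ _ _ (legr a) (legl b) ∘ en_pr (span_comp a b) i k).

(** An entry of the composite lies over [J] through the middle leg. Fixing that index at [j] puts
    the two components into the entries [(i, j)] and [(j, k)], so the fibre is the summand at [j] of
    the matrix product. *)
Lemma en_comp_fibre (j : J) :
  is_fibre en_comp_index j (pbpair (en_compP2 a b i j k)).
Proof.
rewrite /en_comp_index; split=> [|X h hj].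
  rewrite compmA (compmA pb1) !pb1_pbpair.
  exact: const_comp (en_mat_legr a i j).
have ha : span_index a ∘ (pb1 ∘ (pb1 ∘ h)) = cst (i, j) X.
  apply/span_index_const; split; last by rewrite -hj !compmA.
  by have := const_comp h (en_mat_legl (span_comp a b) i k); rewrite /= compmA.
have hb : span_index b ∘ (pb2 ∘ (pb1 ∘ h)) = cst (j, k) X.
  apply/span_index_const; split; first by rewrite -pb_commA -hj !compmA.
  by have := const_comp h (en_mat_legr (span_comp a b) i k); rewrite /= compmA.
have [m [mE _]] := (en_fibre a i j).2 X _ ha.
have [n [nE _]] := (en_fibre b j k).2 X _ hb.
exists (pairm n m); split=> [|l lE].
  apply: en_ext; rewrite -compmA pb1_pbpair.
  by apply: pb_ext; rewrite -compmA ?pb1_pbpair ?pb2_pbpair compmA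
    ?pr1_pairm ?pr2_pairm.
apply: prod_ext; rewrite ?pr1_pairm ?pr2_pairm.
  apply: (fibre_monic (en_fibre b j k)).
  rewrite nE -lE -(compmA pb1) pb1_pbpair -(compmA pb2) pb2_pbpair.
  by rewrite compmA.
apply: (fibre_monic (en_fibre a i j)).
by rewrite mE -lE -(compmA pb1 (pbpair _)) pb1_pbpair -(compmA pb1 (pbpair _))
  pb1_pbpair compmA.
Qed.

Lemma en_comp_iso : is_iso (en_comp a b i k).
Proof. by apply/coproduct_copair_iso; apply: C en_comp_fibre. Qed.
End EnComp.

(* Over the entry [(i, j)] the points [i] and [j] of [pt I] agree, so the
   family [fun k => mat_id k j], whose coproduct is [1] placed over [j], has
   its fibre at [i] there. *)
Lemma en_unit_iso (I : SmallSet) (i j : I) : is_iso (en_unit L S i j).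
Proof.
pose X k := @mat_id V L S I k j.
pose e0 : Hom (one L) (X j) := @inj V S (j = j) (fun _ => one L) erefl.
pose Q := en_mat (span_unit L S I) i j.
have QE : cst i Q = cst j Q.
  by rewrite -(en_mat_legl (span_unit L S I) i j) -en_mat_legr.
have hX : index_map L S X ∘ (@inj V S I X j ∘ (e0 ∘ bang Q)) = cst i Q.
  by rewrite QE; apply: const_comp (index_map_inj _ _ _ _).
have [g [gE _]] := (U X i).2 Q _ hX.
have incl k (e : k = j) : @inj V S I X k ∘ @inj V S (k = j) (fun _ => one L) e
    = @inj V S I X j ∘ e0 by subst k.
exists g; split.
  apply: coprod_ext => e; rewrite comp1m; apply: (fibre_monic (U X i)).
  rewrite incl (compmA g) -(compmA _ g) gE !compmA.
  by rewrite (one_ext (bang Q ∘ _) (idm _)) compm1.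
(* The legs of the unit span are identities, so every map into [Q] becomes constant after [pb1].
   Hence any two parallel maps into [Q] agree, which settles the remaining composite. *)
have pbE Z (h : Hom Z Q) : pb1 ∘ h = cst i Z.
  rewrite -(const_comp h (en_mat_legl (span_unit L S I) i j)).
  by rewrite /= comp1m.
by apply: en_ext; rewrite !pbE.
Qed.
End Covering.
End IntEnFibres.

(** * The adjunction between Int and En *)

Section IntEnAdjunction.
Context (V : Category) (L : FiniteLimits V) (E : CartesianClosed L)
  (S : SmallCoproducts V).
Local Notation pt := (copower1 L S).
Local Notation MatV := (Mat E S).
Local Notation SpanV := (Span L S).
Local Notation IntV := (Int E S).
Local Notation EnV := (En E S).

Lemma mat_cell_iso (I J : SmallSet) (M N : mat V I J)
    (f : mat_cell M N (fun i => i) (fun j => j)) :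
  @cell_iso MatV I J I J M N (fun i => i) (fun j => j) f <->
  forall i j, is_iso (f i j).
Proof.
split=> [fI i j|fI].
  have [g [gf fg]] := @globular_inverse MatV I J M N f fI.
  have ev (P : mat V I J) (h h' : mat_cell P P (fun i => i) (fun j => j)) :
      h = h' -> h i j = h' i j by move=> ->.
  exists (g i j); split.
    exact: ev (@pack_inj MatV I J I J M M _ _ _ _ gf).
  exact: ev (@pack_inj MatV I J I J N N _ _ _ _ fg).
have [g gP] := dependent_choice_fun (fun i => dependent_choice_fun (fI i)).
exists (fun i => i), (fun j => j), g.
by split; apply: mat_pack_eq => i j; case: (gP i j).
Qed.

(** An inverse of the map of apexes automatically respects the legs, since the vertical boundary is
    the identity. *)
Lemma span_cell_iso (I J : SmallSet) (a b : span L S I J)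
    (f : span_cell a b (fun i => i) (fun j => j)) :
  @cell_iso SpanV I J I J a b (fun i => i) (fun j => j) f <->
  is_iso (span_map f).
Proof.
split=> [fI|[g [gf fg]]].
  have [g [gf fg]] := @globular_inverse SpanV I J a b f fI.
  have ev (c : span L S I J) (h h' : span_cell c c (fun i => i) (fun j => j)) :
      h = h' -> span_map h = span_map h' by move=> ->.
  exists (span_map g); split.
    exact: ev (@pack_inj SpanV I J I J a a _ _ _ _ gf).
  exact: ev (@pack_inj SpanV I J I J b b _ _ _ _ fg).
have gl : legl a ∘ g = copower1_map L S (fun i => i) ∘ legl b.
  apply: leg_id; apply: (iso_epic (m := span_map f)); first by exists g.
  by rewrite compmA gf compm1 span_mapl copower1_map1 comp1m.
have gr : legr a ∘ g = copower1_map L S (fun i => i) ∘ legr b.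
  apply: leg_id; apply: (iso_epic (m := span_map f)); first by exists g.
  by rewrite compmA gf compm1 span_mapr copower1_map1 comp1m.
exists (fun i => i), (fun j => j), (Build_span_cell gl gr).
by split; apply: span_pack_eq.
Qed.

Lemma eta_cell_nat (I J K K' : SmallSet) (M : mat V I J) (N : mat V K K')
    (u : I -> K) (v : J -> K') (f : mat_cell M N u v) (i : I) (j : J) :
  en_cell (int_cell L S f) i j ∘ eta_cell L S M i j
  = eta_cell L S N (u i) (v j) ∘ f i j.
Proof.
apply: en_ext; rewrite /en_cell /eta_cell; cat_norm.
by rewrite int_copair_inj.
Qed.

Lemma eps_cell_nat (I J K K' : SmallSet) (a : span L S I J)
    (b : span L S K K') (u : I -> K) (v : J -> K') (f : span_cell a b u v) :
  span_map f ∘ span_map (eps_cell a)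
  = span_map (eps_cell b) ∘ span_map (int_cell L S (en_cell f)).
Proof.
apply: int_ext => i j; rewrite /= !compmA !int_copair_inj -compmA.
by rewrite int_copair_inj /en_cell pb1_pbpair.
Qed.

Lemma eps_eta_int (I J : SmallSet) (M : mat V I J) :
  span_map (eps_cell (int_span L S M))
    ∘ span_map (int_cell L S (eta_cell L S M))
  = idm _.
Proof.
apply: int_ext => i j; rewrite /= !compmA int_copair_inj -compmA.
by rewrite int_copair_inj /eta_cell pb1_pbpair comp1m.
Qed.

Lemma en_eps_eta (I J : SmallSet) (a : span L S I J) (i : I) (j : J) :
  en_cell (eps_cell a) i j ∘ eta_cell L S (en_mat a) i j = idm _.
Proof.
apply: en_ext; rewrite /en_cell /eta_cell; cat_norm.
by rewrite int_copair_inj.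
Qed.

Definition int_en_unit : VTrans (dm_id MatV) (dm_comp EnV IntV).
Proof.
refine (@Build_VTrans MatV MatV (dm_id MatV) (dm_comp EnV IntV)
  (@Build_NatTrans SET SET (functor_id SET) (functor_comp EnV IntV)
     (fun I => idm I) (fun _ _ _ => erefl))
  (fun I J M => eta_cell L S M) _).
move=> I J I' J' M M' u v f; apply: mat_pack_eq => i j.
exact: eta_cell_nat.
Defined.

Definition int_en_counit : VTrans (dm_comp IntV EnV) (dm_id SpanV).
Proof.
refine (@Build_VTrans SpanV SpanV (dm_comp IntV EnV) (dm_id SpanV)
  (@Build_NatTrans SET SET (functor_comp IntV EnV) (functor_id SET)
     (fun I => idm I) (fun _ _ _ => erefl))
  (fun I J a => eps_cell a) _).
move=> I J I' J' a a' u v f; apply: span_pack_eq.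
exact: eps_cell_nat.
Defined.

Definition int_en_cell_unit :
  NatTrans (functor_id (cell_cat MatV))
    (functor_comp (cell_functor EnV) (cell_functor IntV)).
Proof.
refine (@Build_NatTrans _ _ (functor_id (cell_cat MatV))
  (functor_comp (cell_functor EnV) (cell_functor IntV))
  (fun M => packed (vt1 int_en_unit (hor_arr M))) _).
by move=> M N [u [v f]]; apply: (vt1_nat int_en_unit f).
Defined.

Definition int_en_cell_counit :
  NatTrans (functor_comp (cell_functor IntV) (cell_functor EnV))
    (functor_id (cell_cat SpanV)).
Proof.
refine (@Build_NatTrans _ _
  (functor_comp (cell_functor IntV) (cell_functor EnV))
  (functor_id (cell_cat SpanV))
  (fun a => packed (vt1 int_en_counit (hor_arr a))) _).
by move=> a b [u [v f]]; apply: (vt1_nat int_en_counit f).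
Defined.

(** Stated between ordinary categories of 2-cells, so that invertibility of this particular unit and
    counit can be deduced from any equivalence involving Int or En. *)
Definition int_en_adjunction :
  Adjunction (cell_functor IntV) (cell_functor EnV).
Proof.
refine (@Build_Adjunction _ _ (cell_functor IntV) (cell_functor EnV)
  int_en_cell_unit int_en_cell_counit _ _).
- by move=> [I J M]; apply: span_pack_eq; apply: eps_eta_int.
- by move=> [I J a]; apply: mat_pack_eq => i j; apply: en_eps_eta.
Defined.

Lemma int_en_mates : mates int_en_unit int_en_counit.
Proof.
split.
- move=> I; apply: mat_pack_eq => i j; apply: coprod_ext => e.
  apply: en_ext; rewrite /= /en_unit /en_cell /mat_idc /eta_cell; cat_norm.
  by rewrite -compmA int_copair_inj copair_inj.
- move=> I J K M N; apply: mat_pack_eq => i k; apply: coprod_ext => j.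
  apply: en_ext; rewrite /= /en_comp /en_cell /mat_compc /eta_cell; cat_norm.
  rewrite -compmA int_copair_inj copair_inj.
  by apply: pb_ext; cat_norm.
- move=> I; apply: span_pack_eq; apply: int_ext => i j; apply: coprod_ext => e.
  rewrite /= copower1_map1 comp1m (compmA (int_copair _ _) (int_copair _ _)).
  rewrite !int_copair_inj -compmA int_copair_inj /en_unit compmA !copair_inj.
  by rewrite pb1_pbpair.
- move=> I J K a b; apply: span_pack_eq; apply: int_ext => i k.
  apply: coprod_ext => j.
  rewrite /= compmA int_copair_inj.
  rewrite [LHS]compmA copair_inj (compmA (int_copair _ _) (int_copair _ _)).
  rewrite int_copair_inj -compmA int_copair_inj /en_comp compmA copair_inj.
  rewrite pb1_pbpair.
  apply: pb_ext; cat_norm.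
    by rewrite -compmA int_copair_inj.
  by rewrite -compmA int_copair_inj.
Qed.

(** * Recovering the fibre conditions from the adjunction *)

Section EquivalenceFibres.
Context (adjI : is_adjoint_equivalence int_en_adjunction).

Lemma adjoint_eta_iso (I J : SmallSet) (M : mat V I J) (i : I) (j : J) :
  is_iso (eta_cell L S M i j).
Proof.
move: i j; apply/(mat_cell_iso (eta_cell L S M)).
by apply/(@cell_iso_packed MatV); apply: (adjI.1 (@harrow MatV I J M)).
Qed.

Lemma adjoint_eps_iso (I J : SmallSet) (a : span L S I J) :
  is_iso (span_map (eps_cell a)).
Proof.
apply/(span_cell_iso (eps_cell a)).
by apply/(@cell_iso_packed SpanV); apply: (adjI.2 (@harrow SpanV I J a)).
Qed.

(** The copower by a one-element set is terminal: its identity factors through its only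
    coprojection. *)
Lemma pt_unit_ext (X : V) (f : Hom X (pt unit)) :
  f = @inj V S unit (fun _ => one L) tt ∘ bang X.
Proof.
have ptE : idm (pt unit) = @inj V S unit (fun _ => one L) tt ∘ bang (pt unit).
  apply: coprod_ext => -[]; rewrite comp1m compmA.
  by rewrite (one_ext (bang _ ∘ _) (idm _)) compm1.
by rewrite -[LHS]comp1m ptE compmA; congr (_ ∘ _); apply: one_ext.
Qed.

(* A family indexed by [I] is a matrix [I -> unit], and an object over
   [pt I] is a span from [I] to [unit]. *)
Lemma adjoint_coproduct_fibres : coproduct_fibres L S.
Proof.
move=> I X i; split=> [|Z h hE]; first exact: index_map_inj.
pose M : mat V I unit := fun i _ => X i.
(* [s] and [r] translate between the coproduct indexed by [I] and the one indexed by [I * unit]. *)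
pose s : Hom (coprod S X) (int_apex S M) := copair (fun i => int_inj S M i tt).
pose r : Hom (int_apex S M) (coprod S X) :=
  int_copair S (M := M) (fun i _ => inj i).
have rs : r ∘ s = idm _.
  by apply: coprod_ext => k; rewrite compmA copair_inj comp1m int_copair_inj.
have sl : legl (int_span L S M) ∘ s = index_map L S X.
  by apply: coprod_ext => k; rewrite compmA copair_inj index_map_inj int_legl.
have hl : legl (int_span L S M) ∘ (s ∘ h) = inj i ∘ bang Z.
  by rewrite -compmA sl.
have hP := en_matP hl (pt_unit_ext (legr (int_span L S M) ∘ (s ∘ h))).
have etaI := adjoint_eta_iso M i tt; case: (etaI) => g [ge eg].
have injE : pb1 ∘ eta_cell L S M i tt = int_inj S M i tt by apply: pb1_pbpair.
(* [h] is lifted to the fibre of the span over [(i, tt)] and carried back to [X i] by the inverse of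
   the unit. *)
exists (g ∘ pbpair hP); split.
  have -> : @inj V S I X i = r ∘ int_inj S M i tt by rewrite int_copair_inj.
  rewrite -injE !compmA -(compmA _ g) eg comp1m pb1_pbpair.
  by rewrite -(compmA r) rs comp1m.
move=> k kE; apply: (iso_monic etaI); rewrite -(compmA _ g) eg comp1m.
apply: en_ext; rewrite pb1_pbpair -compmA injE -kE -compmA.
by rewrite copair_inj.
Qed.

Lemma adjoint_fibres_cover : fibres_cover L S.
Proof.
move=> I A p Y y yF.
pose a := @Build_span V L S I unit A p (inj tt ∘ bang A).
(* The leg to the terminal object [pt unit] imposes no condition, so the entries of En at [a] are
   fibres of [p]; the invertible counit then exhibits [A] as their coproduct. *)
have piE i : is_fibre p i (@pb1 V L _ _ _ (pairm (legl a) (legr a))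
    (@pairm V L (pt I) (pt unit) (one L) (inj i) (inj tt))).
  split=> [|X h hE]; first exact: (en_mat_legl a i tt).
  have hP := en_matP (a := a) hE (pt_unit_ext (legr a ∘ h)).
  exists (pbpair hP); split=> [|k kE]; first exact: pb1_pbpair.
  by apply: en_ext; rewrite pb1_pbpair kE.
apply: fibres_coproduct piE yF _ => Z f.
pose y' (q : I * unit) : Hom (en_mat a q.1 q.2) A := pb1.
have [g [gE gU]] := iffRL (coproduct_copair_iso S y') (adjoint_eps_iso a) Z
  (fun q : I * unit => match q.2 as t return Hom (en_mat a q.1 t) Z with
                       | tt => f q.1 end).
exists g; split=> [i|k kE]; first exact: (gE (i, tt)).
by apply: gU => -[i []]; apply: kE.
Qed.
End EquivalenceFibres.

(** The inverse given by the double equivalence need not be En. It only makes Int fully faithful and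
    essentially surjective on 2-cells, which suffices for its adjunction with En. *)
Lemma int_equivalence_adjoint :
  oplax_double_equivalence IntV -> is_adjoint_equivalence int_en_adjunction.
Proof.
move=> [_ [G [_ [eta [eps [_ _ etaI epsI]]]]]].
have eqv := cell_functor_equivalence etaI epsI.
apply: left_adjoint_equivalence (equivalence_fully_faithful eqv) _.
exact: equivalence_essentially_surjective eqv.
Qed.

Lemma en_equivalence_adjoint :
  lax_double_equivalence EnV -> is_adjoint_equivalence int_en_adjunction.
Proof.
move=> [_ [G [_ [eta [eps [_ _ etaI epsI]]]]]].
have eqv := cell_functor_equivalence etaI epsI.
apply: right_adjoint_equivalence (equivalence_fully_faithful eqv) _.
exact: equivalence_essentially_surjective eqv.
Qed.

(** * Double equivalences from the fibre conditions *)

Section Covering.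
Context (U : coproduct_fibres L S) (C : fibres_cover L S).

Lemma int_pseudo : oplax_is_pseudo IntV.
Proof.
split=> [I|I J K M N].
  by apply/(span_cell_iso (int_unit L S I)); apply: int_unit_iso.
by apply/(span_cell_iso (int_comp L S M N)); apply: int_comp_iso.
Qed.

Lemma en_pseudo : lax_is_pseudo EnV.
Proof.
split=> [I|I J K a b].
  by apply/(mat_cell_iso (@en_unit V L S I)) => i j; apply: en_unit_iso.
by apply/(mat_cell_iso (en_comp a b)) => i k; apply: en_comp_iso.
Qed.

Lemma int_en_unit_iso : vt_iso int_en_unit.
Proof.
split=> [I|I J M]; first by exists (idm I).
by apply/(mat_cell_iso (eta_cell L S M)) => i j; apply: eta_cell_iso.
Qed.

Lemma int_en_counit_iso : vt_iso int_en_counit.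
Proof.
split=> [I|I J a]; first by exists (idm I).
by apply/(span_cell_iso (eps_cell a)); apply: eps_cell_iso.
Qed.

Lemma covering_int_equivalence : oplax_double_equivalence IntV.
Proof.
exact: conjoint_oplax_equivalence int_en_mates int_pseudo en_pseudo
  int_en_unit_iso int_en_counit_iso.
Qed.

Lemma covering_en_equivalence : lax_double_equivalence EnV.
Proof.
exact: conjoint_lax_equivalence int_en_mates int_pseudo en_pseudo
  int_en_unit_iso int_en_counit_iso.
Qed.
End Covering.

Lemma adjoint_extensive :
  is_adjoint_equivalence int_en_adjunction -> extensive S.
Proof.
move=> adjI; exact: fibres_extensive (adjoint_coproduct_fibres adjI)
  (adjoint_fibres_cover adjI).
Qed.

Lemma extensive_fibres :
  extensive S -> coproduct_fibres L S /\ fibres_cover L S.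
Proof.
by move=> ext; apply: adjoint_equivalence_fibres => I;
  apply: extensive_adjoint_equivalence.
Qed.
End IntEnAdjunction.

(** * Equivalence of the four conditions *)

Theorem proposition4p6 (V : Category) (L : FiniteLimits V)
    (E : CartesianClosed L) (S : SmallCoproducts V) :
  ((forall I : SmallSet, is_adjoint_equivalence (coprod_adjunction L S I))
     <-> extensive S)
  /\ (extensive S <-> oplax_double_equivalence (Int E S))
  /\ (oplax_double_equivalence (Int E S)
        <-> lax_double_equivalence (En E S)).
Proof.
(* Extensivity is the hub: each of the two double equivalences is linked to it in both directions,
   and they are compared with each other through it. *)
have extInt : extensive S -> oplax_double_equivalence (Int E S).
  by case/(extensive_fibres L) => U C; apply: covering_int_equivalence.
have extEn : extensive S -> lax_double_equivalence (En E S).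
  by case/(extensive_fibres L) => U C; apply: covering_en_equivalence.
have intExt : oplax_double_equivalence (Int E S) -> extensive S.
  by move/int_equivalence_adjoint/adjoint_extensive.
have enExt : lax_double_equivalence (En E S) -> extensive S.
  by move/en_equivalence_adjoint/adjoint_extensive.
split; [|split]; split; auto.
  by case/adjoint_equivalence_fibres; apply: fibres_extensive.
by move=> ext I; apply: extensive_adjoint_equivalence.
Qed.
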